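(* Let $k$ be a field of odd characteristic $p$ and let $G$ be a finite $p$-group with cyclic commutator subgroup $G'$. Let $H$ be a group such that $kG$ and $kH$ are isomorphic as $k$-algebras. Then: (a) for every $k$-algebra isomorphism $\phi:kG\to kH$ preserving augmentation one has $\phi(I({\rm C}_G(G'))kG)=I({\rm C}_H(H'))kH$; (b) ${\mathrm D}_i({\rm C}_G(G'))/{\mathrm D}_{i+1}({\rm C}_G(G'))\cong {\mathrm D}_i({\rm C}_H(H'))/{\mathrm D}_{i+1}({\rm C}_H(H'))$ for every $i\ge1$; (c) $\exp({\rm C}_G(G'))=\exp({\rm C}_H(H'))$; (d) ${\rm C}_G(G')/G'\cong {\rm C}_H(H')/H'$; (e) ${\rm C}_G(G')/{\rm C}_G(G')'\cong {\rm C}_H(H')/{\rm C}_H(H')'$.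
   Context: For a group $\Gamma$ and a subgroup $N$, $I(N)$ denotes the augmentation ideal of $kN$ (the kernel of the $k$-linear map $kN\to k$ sending each group element to $1$), and $I(N)k\Gamma$ is the relative augmentation ideal. An isomorphism preserves augmentation if it is compatible with the augmentation maps $kG\to k$, $kH\to k$. For a finite $p$-group $N$, the Jennings series is ${\mathrm D}_n(N)=\prod_{ip^j\ge n}\mho_j(\gamma_i(N))$, where $\gamma_i$ is the lower central series and $\mho_j(X)=\langle x^{p^j}:x\in X\rangle$. *)

(* Defs.v *)
From HB Require Import structures.
From mathcomp Require Import all_boot all_order all_algebra all_fingroup all_solvable.
Set Implicit Arguments. Unset Strict Implicit. Unset Printing Implicit Defensive.
Import GRing.Theory.
Local Open Scope ring_scope.

Section GroupAlgebra.
Variables (k : fieldType) (gT : finGroupType).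

(* Elements of the group algebra are k-valued functions on gT; the group
   algebra kG of G : {set gT} consists of those supported in G. *)
Local Notation gfun := {ffun gT -> k}.

Definition in_galg (G : {set gT}) (a : gfun) : Prop :=
  forall x, x \notin G -> a x = 0.

Definition gdelta (g : gT) : gfun := [ffun x => (x == g)%:R].

Definition gscale (c : k) (a : gfun) : gfun := [ffun x => c * a x].

Definition gconv (a b : gfun) : gfun :=
  [ffun z => \sum_(x : gT) a x * b (x^-1 * z)%g].

Definition gaug (a : gfun) : k := \sum_(x : gT) a x.

Definition aug_ideal (N : {set gT}) (a : gfun) : Prop :=
  in_galg N a /\ gaug a = 0.

Definition rel_aug_ideal (N G : {set gT}) (a : gfun) : Prop :=
  exists (m : nat) (u v : 'I_m -> gfun),
    [/\ forall i, aug_ideal N (u i), forall i, in_galg G (v i)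
      & a = \sum_(i < m) gconv (u i) (v i)].

End GroupAlgebra.

Notation gfun k gT := {ffun gT -> k}.

Definition galg_iso (k : fieldType) (gT hT : finGroupType)
  (G : {set gT}) (H : {set hT}) (phi : gfun k gT -> gfun k hT) : Prop :=
  [/\ (forall a : gfun k gT, in_galg G a -> in_galg H (phi a)) /\
      (forall a b : gfun k gT, in_galg G a -> in_galg G b -> phi a = phi b -> a = b) /\
      (forall b : gfun k hT, in_galg H b -> exists2 a, in_galg G a & phi a = b),
      forall (c : k) (a b : gfun k gT), in_galg G a -> in_galg G b ->
        phi (gscale c a + b) = gscale c (phi a) + phi b,
      forall a b : gfun k gT, in_galg G a -> in_galg G b ->
        phi (gconv a b) = gconv (phi a) (phi b)
    & phi (gdelta k 1%g) = gdelta k 1%g].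

Definition preserves_aug (k : fieldType) (gT hT : finGroupType)
  (G : {set gT}) (phi : gfun k gT -> gfun k hT) : Prop :=
  forall a : gfun k gT, in_galg G a -> gaug (phi a) = gaug a.

Definition mhoP (gT : finGroupType) (p j : nat) (X : {set gT}) : {set gT} :=
  (<<[set (x ^+ (p ^ j))%g | x in X]>>)%g.

(* Jennings series D_n(N) = prod_{i p^j >= n} mho_j(gamma_i(N)).
   Since mho_j(gamma_i(N)) decreases in i and in j, the factors with
   i <= n and j <= n already generate the whole product (for i > n the
   factor is contained in the one for (n,0); for j > n the one for
   (i, minimal j) contains it, and that minimal j is <= n since p^n >= n).
   All factors are normal in N, so the product is the generated subgroup. *)
Definition jennings (gT : finGroupType) (p n : nat) (N : {set gT}) : {set gT} :=
  (<<\bigcup_(i < n.+1 | (0 < i)%N)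
      \bigcup_(j < n.+1 | (n <= i * p ^ j)%N) mhoP p j ('L_i(N))>>)%g.

(* Main.v *)
(** Let J = I(G')kG, z a generator of G', y = z - 1, C = C_G(G') and
    q = p^t = |Z(G) :&: G'|.  The ideal J is generated by the commutators of kG, it
    equals y kG = kG y, and [J^i, J^j] lies in J^(i+j+1).  Commutators and central
    elements of augmentation 0 generate I(Z(G)G')kG, and x^(p^s) lies in this ideal if
    and only if x lies in I(Om_s)kG, where Om_s = {g | g^(p^s) in Z(G)G'}.  Since
    C = Om_t, and t can be read off from the indices |Om_(s+1) : Om_s|, which are at most
    p for s >= t and larger than p for s = t - 1, an isomorphism maps I(C)kG to its
    counterpart.

    For N = p^j, Jacobson's formula yields
      (sum_g a_g g)^N = sum_g a_g^N g^N   modulo J^(N - N/p).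
    Let U_j be the subgroup of the N-th powers of elements of C.  The N-th powers of the
    elements of I(C)kG determine I(U_j G')kG when taken modulo J, and they determine
    which powers of z lie in U_j when taken modulo J^(N - N/p).  Hence |U_j G'| and
    |U_j :&: G'| are invariants; as C has class at most 2 and C' = Z(G) :&: G', all the
    isomorphism types in question depend only on these numbers and on |G'|, |C|, q. *)
Require Import Defs.
From HB Require Import structures.
From mathcomp Require Import all_boot all_order all_algebra all_fingroup all_solvable.
From mathcomp Require Import zify.
Set Implicit Arguments. Unset Strict Implicit. Unset Printing Implicit Defensive.
Import GRing.Theory.

(** * Geometric sums modulo powers of an odd prime *)

(** An isomorphism need not send z - 1 to its counterpart for H; it only matches the ideals these
    elements generate. Hence every subgroup is encoded by an ideal with generators that any
    isomorphism must respect. Modulo J only the abelian group G/G' is visible, so U_j :&: G' is lost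
    there; this is the reason for the finer modulus J^(N - N/p). It is fine enough: for a < j and
    odd p, N - N/p = (p - 1)p^(j-1) exceeds p^a, so the error is a higher multiple of y^(p^a) =
    z^(p^a) - 1, and nilpotency of y removes it. Oddness enters twice more. It makes Aut(G') cyclic,
    and for r = 1 mod p it gives 1 + r + ... + r^(N-1) the exact p-part N. Such sums arise because
    an element x acts on G' by an exponent r, so that [x^n, h] is the power of [x, h] with exponent
    1 + r + ... + r^(n-1). Nothing is assumed about H' itself: its cyclicity is derived from the
    fact that elements of kH of nonzero augmentation are units. *)

Definition geom (r n : nat) : nat := (\sum_(i < n) r ^ i)%N.

Section Geom.
Local Open Scope nat_scope.
Variables (p : nat).
Hypotheses (pr_p : prime p) (odd_p : odd p).

Lemma geomS r n : geom r n.+1 = geom r n + r ^ n.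
Proof. by rewrite /geom big_ord_recr. Qed.

Lemma geomD r m n : geom r (m + n) = geom r m + r ^ m * geom r n.
Proof.
elim: n => [|n IH]; first by rewrite addn0 /geom big_ord0 muln0 addn0.
by rewrite addnS !geomS IH mulnDr addnA expnD.
Qed.

Lemma geomM r m n : geom r (m * n) = geom r m * geom (r ^ m) n.
Proof.
elim: n => [|n IH]; first by rewrite muln0 /geom !big_ord0 muln0.
by rewrite mulnS addnC geomD geomS mulnDr IH -expnM [r ^ _ * _]mulnC.
Qed.

Lemma expn_1modp r i : r = 1 %[mod p] -> r ^ i = 1 %[mod p].
Proof. by move=> hr; rewrite -modnXm hr modnXm exp1n. Qed.

Lemma geom_modp r n : r = 1 %[mod p] -> geom r n = n %[mod p].
Proof.
move=> hr; elim: n => [|n IH]; first by rewrite /geom big_ord0.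
by rewrite geomS -addn1 -modnDm IH expn_1modp // modnDm.
Qed.

Lemma sum_ord_dvd : p %| \sum_(i < p) i.
Proof.
have := bin2_sum p; rewrite big_mkord => ->.
by rewrite prime_dvd_bin //= (odd_prime_gt2 odd_p pr_p).
Qed.

Lemma expn_mod_sqr m n : exists w, (1 + p * m) ^ n = 1 + p * m * n + p ^ 2 * w.
Proof.
elim: n => [|n [w IH]]; first by exists 0; rewrite expn0 !muln0.
exists (m ^ 2 * n + w * (1 + p * m)); rewrite expnS IH; nia.
Qed.

Lemma geom_mod_sqr m n :
  exists w, geom (1 + p * m) n = n + p * m * 'C(n, 2) + p ^ 2 * w.
Proof.
elim: n => [|n [w IH]]; first by exists 0; rewrite /geom big_ord0 !muln0.
have [w' hw'] := expn_mod_sqr m n.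
exists (w + w'); rewrite geomS IH hw' binS bin1; nia.
Qed.

(** With [r = 1 + p * m] the sum is [p + p * m * 'C(p, 2)] modulo [p ^ 2], and an odd [p] divides
    ['C(p, 2)]. For [p = 2] and [r = 3] the value 4 has one factor too many. *)
Lemma geom_prime r : r = 1 %[mod p] -> exists2 u, geom r p = p * u & ~~ (p %| u).
Proof.
move=> hr; have p1 := prime_gt1 pr_p.
have [m ->] : exists m, r = 1 + p * m.
  by exists (r %/ p); rewrite {1}(divn_eq r p) hr modn_small // mulnC addnC.
have [w ->] := geom_mod_sqr m p.
have /dvdnP[c hc] : p %| 'C(p, 2).
  by rewrite prime_dvd_bin //= (odd_prime_gt2 odd_p pr_p).
exists (1 + p * (m * c + w)); first by rewrite hc; nia.
by rewrite dvdn_addl ?dvdn_mulr // dvdn1 neq_ltn p1 orbT.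
Qed.

Lemma geom_pexp r j : r = 1 %[mod p] ->
  exists2 u, geom r (p ^ j) = p ^ j * u & ~~ (p %| u).
Proof.
move=> hr; elim: j => [|j [u IH pu]].
  exists 1; first by rewrite expn0 /geom big_ord1.
  by rewrite dvdn1 neq_ltn (prime_gt1 pr_p) orbT.
have [v hv pv] := geom_prime (expn_1modp (p ^ j) hr).
exists (u * v); last by rewrite Euclid_dvdM // negb_or pu.
by rewrite expnSr geomM IH hv; nia.
Qed.

(** Indices are split as [M * a + b] with [b < M]. This drives the induction in [dvdn_sum_geom],
    whose sums are the exponents of [[~ c, h]] in [(h * c) ^+ (p ^ j)]. *)
Lemma sum_geom_addn r M n :
  \sum_(i < M * n) geom r i =
  \sum_(a < n) (M * geom r (M * a) + r ^ (M * a) * \sum_(i < M) geom r i).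
Proof.
elim: n => [|n IH]; first by rewrite muln0 !big_ord0.
rewrite mulnS addnC big_split_ord /= IH big_ord_recr /=; congr (_ + _).
under [LHS]eq_bigr do rewrite geomD.
by rewrite big_split /= sum_nat_const card_ord -big_distrr.
Qed.

Lemma dvdn_sum_geom r j : r = 1 %[mod p] -> p ^ j %| \sum_(i < p ^ j) geom r i.
Proof.
move=> hr; elim: j => [|j IH]; first by rewrite dvd1n.
rewrite expnSr sum_geom_addn big_split /= -!(big_distrr, big_distrl) /=.
apply: dvdn_add.
  rewrite dvdn_mul //.
  rewrite /dvdn -modn_summ; under eq_bigr do rewrite geom_modp //.
  by rewrite modn_summ -big_distrr /= -/(dvdn _ _) dvdn_mull // sum_ord_dvd.
rewrite mulnC dvdn_mul //.
rewrite /dvdn -modn_summ; under eq_bigr do rewrite expn_1modp //.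
by rewrite modn_summ sum1_card card_ord modnn.
Qed.
End Geom.

(** * Finite p-groups with cyclic derived subgroup *)

Lemma mhoP_group_set (gT : finGroupType) p j (X : {set gT}) : group_set (mhoP p j X).
Proof. exact: groupP. Qed.
Canonical mhoP_group (gT : finGroupType) p j (X : {set gT}) := Group (mhoP_group_set p j X).

(** When [M] contains the derived subgroup this is the preimage of the elements of the abelian group
    [G / M] killed by [n]. The groups Om_s are the case of M = Z(G)G' and n = p^s. *)
Definition root_set (gT : finGroupType) (M G : {set gT}) (n : nat) : {set gT} :=
  [set x in G | x ^+ n \in M]%g.

Lemma root_set_group_set (gT : finGroupType) (M G : {group gT}) n :
  G^`(1)%g \subset M -> M \subset G -> group_set (root_set M G n).
Proof.
move=> sDM sMG; have nMG := sub_der1_norm sDM sMG.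
have cGM := sub_der1_abelian sDM.
have memP x : x \in G -> (x ^+ n \in M)%g = (coset M x ^+ n == 1)%g.
  move=> Gx; have Nx := subsetP nMG _ Gx.
  rewrite -morphX //=; apply/idP/eqP=> [/coset_id // |].
  by apply: coset_idr; rewrite groupX.
apply/group_setP; split=> [|x y]; first by rewrite inE group1 expg1n group1.
rewrite !inE => /andP[Gx +] /andP[Gy +]; rewrite groupM // !memP ?groupM //.
have [Nx Ny] := (subsetP nMG _ Gx, subsetP nMG _ Gy).
rewrite morphM //= => /eqP x1 /eqP y1; rewrite expgMn ?x1 ?y1 ?mulg1 //.
by apply: (centsP cGM); rewrite mem_quotient.
Qed.

Section CyclicDerived.
Local Open Scope group_scope.
Variables (p : nat) (gT : finGroupType) (G : {group gT}).
Hypotheses (pr_p : prime p) (odd_p : odd p).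
Hypotheses (pG : p.-group G) (cycD : cyclic G^`(1)).

Local Notation D := G^`(1).
Local Notation C := 'C_G(D).
Local Notation q := #|'Z(G) :&: D|.

Let pD : p.-group D. Proof. exact: pgroupS (der_sub 1 G) pG. Qed.
Let cDD : abelian D. Proof. exact: cyclic_abelian. Qed.

Lemma cyclic_expg_card_mem (N W : {group gT}) d :
  cyclic N -> W \subset N -> d \in N -> d ^+ #|W| = 1 -> d \in W.
Proof.
move=> cycN sWN Nd dW; rewrite -cycle_subG -(cardSg_cyclic cycN) ?cycle_subG //.
by rewrite -orderE order_dvdn dW.
Qed.

Lemma der1_sub_cent_der1 : D \subset C.
Proof. by rewrite subsetI der_sub. Qed.

Lemma cent_der1_normal : C <| G.
Proof. by have:= subcent_normal G D; rewrite (setIidPl (der_norm 1 G)). Qed.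

(** On the cyclic group [D], [b] acts by some exponent [m]. As [b] has order [p ^ k], the power
    [m ^ (p ^ k)] is 1 modulo the order of [z], hence modulo [p], and by Fermat it is congruent to
    [m]. If [D] is trivial, [m] is arbitrary and 1 is taken instead. *)
Lemma der1_conjXg b : b \in G ->
  exists2 r, (r = 1 %[mod p])%N & {in D, forall d, d ^ b = d ^+ r}.
Proof.
move=> Gb; have [z Dz] := cyclicP cycD.
have zb : z ^ b \in <[z]>.
  by rewrite -Dz memJ_norm ?(subsetP (der_norm 1 G)) // Dz cycle_id.
have zD : z \in D by rewrite Dz cycle_id.
have /cycleP[m zm] := zb; have [k ok] := p_natP (mem_p_elt pG Gb).
have powm i : z ^ (b ^+ i) = z ^+ (m ^ i).
  elim: i => [|i IH]; first by rewrite conjg1.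
  by rewrite expgSr conjgM IH conjXg zm -expgM expnS.
have conjm d : d \in D -> d ^ b = d ^+ m.
  by rewrite Dz => /cycleP[i ->]; rewrite conjXg zm -!expgM mulnC.
have [z1 | ntz] := eqVneq z 1.
  exists 1%N => // d; rewrite Dz z1 cycle1 => /set1P ->; rewrite conj1g expg1n //.
exists m => //; have /= := powm (p ^ k)%N.
rewrite -ok expg_order conjg1 -{1}(expg1 z) => /eqP.
rewrite eq_expg_mod_order ok => /eqP hm.
have pz : p %| #[z].
  have pz : p.-elt z by apply: mem_p_elt pD zD.
  have [[|i] oz] := p_natP pz; last by rewrite oz expnS dvdn_mulr.
  by rewrite -order_eq1 oz expn0 eqxx in ntz.
have {hm} hm : (m ^ (p ^ k) = 1 %[mod p])%N.
  by rewrite -(modn_dvdm _ pz) -hm modn_dvdm.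
have frob i : (m ^ (p ^ i) = m %[mod p])%N.
  elim: i => [|i IH]; first by rewrite expn0 expn1.
  by rewrite expnSr expnM fermat_little.
by rewrite -hm frob.
Qed.

Lemma commXg_geom x h r n : x \in G -> h \in G ->
  {in D, forall d, d ^ x = d ^+ r} -> [~ x ^+ n, h] = [~ x, h] ^+ geom r n.
Proof.
move=> Gx Gh hr; have Dxh : [~ x, h] \in D by rewrite mem_commg.
elim: n => [|n IH]; first by rewrite comm1g /geom big_ord0.
rewrite expgSr commMgJ IH conjXg hr // -expgM -expgSr; congr (_ ^+ _).
by rewrite -(add1n n) geomD expn1 {2}/geom big_ord1 expn0 add1n.
Qed.

(** Conjugation embeds [G / C] into the automorphism group of a cyclic p-group with [p] odd, which
    is cyclic. *)
Lemma quo_cent_der1_cyclic : cyclic (G / C).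
Proof.
have nDG : G \subset 'N(D) by exact: der_norm.
have isoGC : G / C \isog conj_aut D @* G.
  by have := first_isog_loc (conj_aut_morphism D) nDG; rewrite ker_conj_aut.
rewrite (isog_cyclic isoGC) /=; apply: (cyclicS (Aut_conj_aut _ _)).
have [D1 | ntD] := eqVneq D 1.
  by apply: cyclic_small; have /= -> := card_Aut_cyclic cycD; rewrite -[#|_|]/#|D| D1 cards1.
have [m [_ [_ cycF _ _]]] := cyclic_pgroup_Aut_structure pD cycD ntD.
rewrite odd_p; case: (_ == _) => [eqA | [t [_ _ _]]]; first by rewrite -eqA in cycF.
by case; case.
Qed.

Lemma cent_der1_cycle :
  exists2 g, g \in G & forall x, x \in G -> exists2 c, c \in C & exists i, x = c * g ^+ i.
Proof.
have [nCG] := (normal_norm cent_der1_normal, quo_cent_der1_cyclic).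
case=> /cyclicP[gb Egb].
have /morphimP[g Ng Gg gbE] : gb \in G / C by rewrite Egb cycle_id.
exists g => // x Gx.
have : coset C x \in G / C by rewrite mem_quotient.
rewrite Egb => /cycleP[i]; rewrite gbE -morphX // => Exi.
have : x \in C :* (g ^+ i).
  by apply/rcoset_kercosetP; rewrite ?(subsetP nCG) ?groupX.
by case/rcosetP=> c Cc ->; exists c => //; exists i.
Qed.

(** Modulo [[~: C, G]] the subgroup [C] becomes central with cyclic quotient, which forces [G /
    [~: C, G]] to be abelian. *)
Lemma commg_cent_der1 : [~: C, G] = D.
Proof.
have nCG := normal_norm cent_der1_normal.
apply/eqP; rewrite eqEsubset; apply/andP; split; first by rewrite commSg ?subsetIl.
have nRG : G \subset 'N([~: C, G]) by exact: commg_normr.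
apply: der1_min => //.
have sRC : [~: C, G] \subset C by rewrite commg_subl.
apply: (@cyclic_factor_abelian _ (C / [~: C, G])).
  rewrite subsetI quotientS ?subsetIl //=.
  by rewrite quotient_cents2r.
have nRnG : [~: C, G] <| G by rewrite /normal (subset_trans sRC (subsetIl _ _)).
have /isog_cyclic-> := third_isog sRC nRnG cent_der1_normal.
exact: quo_cent_der1_cyclic.
Qed.

(** The commutators [[~ e, g]] with [e] in [C] generate [D]. Subgroups of a cyclic p-group form a
    chain, so one of maximal order generates [D] alone. *)
Lemma cyclic_der1_generator : exists e g, [/\ e \in C, g \in G & D = <[[~ e, g]]>].
Proof.
pose P (x : gT * gT) := (x.1 \in C) && (x.2 \in G).
have P1 : P (1, 1) by rewrite /P !group1.
case: (@arg_maxnP _ (1, 1) P (fun x => #[[~ x.1, x.2]]) P1) => -[e g] /= /andP[Ce Gg] hmax.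
exists e, g; split => //; apply/eqP; rewrite eqEsubset cycle_subG.
have Deg x y : x \in C -> y \in G -> [~ x, y] \in D.
  by case/setIP=> Gx _ Gy; rewrite mem_commg.
rewrite Deg // andbT -{1}commg_cent_der1 gen_subG.
apply/subsetP => _ /imset2P[x y Cx Gy ->].
rewrite -cycle_subG -(cardSg_cyclic cycD) ?cycle_subG ?Deg //.
have := hmax (x, y); rewrite /P /= Cx Gy => /(_ isT).
rewrite -!orderE; have [a ->] := p_natP (mem_p_elt pD (Deg _ _ Cx Gy)).
have [b ->] := p_natP (mem_p_elt pD (Deg _ _ Ce Gg)).
by rewrite leq_exp2l ?prime_gt1 // => /dvdn_exp2l.
Qed.

Let cent_der1_commute x y : x \in C -> y \in D -> commute x y.
Proof. by case/setIP=> _ /centP cxD Dy; apply: cxD. Qed.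

Let sCG : C \subset G := subsetIl _ _.
Let commCG x y : x \in C -> y \in G -> [~ x, y] \in D.
Proof. by case/setIP=> Gx _ Gy; rewrite mem_commg. Qed.

Lemma commXg_cent_der1 n c h : c \in C -> h \in G -> [~ c ^+ n, h] = [~ c, h] ^+ n.
Proof. by move=> Cc Gh; rewrite commXg //; apply: cent_der1_commute (commCG Cc Gh). Qed.

Lemma commMg_cent_der1 c d h : c \in C -> d \in C -> h \in G ->
  [~ c * d, h] = [~ c, h] * [~ d, h].
Proof.
move=> Cc Cd Gh; rewrite commMgJ conjgE.
by rewrite -(cent_der1_commute Cd (commCG Cc Gh)) mulKg.
Qed.

(** Conjugation by [g] multiplies [c] and [d] by [[~ c, g]] and [[~ d, g]]. Both factors lie in [D],
    which [C] centralizes, so they drop out of the commutator of [c] and [d]. *)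
Lemma der1_cent_der1_sub : C^`(1) \subset 'Z(G) :&: D.
Proof.
rewrite subsetI dergS // andbT gen_subG; apply/subsetP=> _ /imset2P[c d Cc Cd ->].
have [Gc Gd] := (subsetP sCG _ Cc, subsetP sCG _ Cd).
apply/centerP; split=> [|g Gg]; first by rewrite groupR.
apply/commgP/conjg_fixP; rewrite conjRg !conjg_mulR.
have Ccg := subsetP der1_sub_cent_der1 _ (commCG Cc Gg).
have Cdg := subsetP der1_sub_cent_der1 _ (commCG Cd Gg).
have Cddg := groupM Cd Cdg.
rewrite commMg_cent_der1 ?(subsetP sCG _ Cddg) //.
have cdg x : x \in C -> [~ x, [~ d, g]] = 1.
  by move=> Cx; apply/eqP/commgP/cent_der1_commute/commCG.
have cgd x : x \in C -> [~ [~ c, g], x] = 1.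
  by move=> Cx; apply/eqP/commgP/commute_sym/cent_der1_commute/commCG.
rewrite cgd // mulg1 commgMJ cdg // mul1g.
apply/conjg_fixP/commgP/commute_sym/cent_der1_commute => //.
exact: commCG.
Qed.

Lemma der1_conj_morph g : g \in G -> {in D &, {morph (fun d => [~ d, g]) : x y / x * y}}.
Proof.
by move=> Gg x y Dx Dy; rewrite /= commMg_cent_der1 ?(subsetP der1_sub_cent_der1).
Qed.

(* The map [d |-> [~ d, g]] on the cyclic group D has kernel 'Z(G) :&: D, hence
   its image is the subgroup of q-th powers. *)
Lemma cent_der1_cycle_comm : exists g, [/\ g \in G,
  forall x, x \in G -> exists2 c, c \in C & exists i, x = c * g ^+ i,
  forall d, d \in D -> exists2 w, w \in D & d ^+ q = [~ w, g]
  & exists N, [/\ (N * q)%N = #|D| & forall d, d \in D -> [~ d, g] ^+ N = 1]].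
Proof.
have [g Gg genG] := cent_der1_cycle; exists g.
pose F := Morphism (der1_conj_morph Gg); pose W := F @* D.
have kerF : 'ker F = 'Z(G) :&: D.
  apply/setP=> d; apply/idP/idP.
    case/morphpreP=> Dd /set1P /= dg1; rewrite inE Dd andbT.
    have Gd := subsetP (der_sub 1 G) _ Dd.
    apply/centerP; split=> // _ /genG[c Cc [i ->]].
    apply: commuteM; last by apply: commuteX; apply/commgP/eqP.
    exact/commute_sym/cent_der1_commute.
  case/setIP=> /centerP[Gd cdG] Dd; apply/morphpreP; split=> //.
  by apply/set1P/eqP/commgP/cdG.
have sWD : W \subset D.
  apply/subsetP=> _ /morphimP[d _ Dd ->] /=.
  by rewrite commCG // (subsetP der1_sub_cent_der1).
have oW : (#|W| * q)%N = #|D|.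
  rewrite -kerF -(LagrangeI D ('ker F)) (setIidPr _) ?subsetIl //.
  by rewrite /W card_morphim setIid mulnC.
split=> // [d Dd|].
  have : d ^+ q \in W.
    apply: (cyclic_expg_card_mem cycD sWD); rewrite ?groupX //.
    by rewrite -expgM mulnC oW expg_cardG.
  by case/morphimP=> w _ Dw ->; exists w.
exists #|W|; split=> // d Dd; apply: expg_cardG.
by rewrite -[[~ d, g]]/(F d) mem_morphim.
Qed.

(** Let [N] be [#|D|] divided by [q]. Then [[~ g ^+ N, d]] is a power of [[~ g, d] ^+ N = 1], since
    [geom r N] is a multiple of [N]. So [g ^+ N] lies in [C], and [g] generates [G] modulo [C]. *)
Lemma cent_der1_index : (#|G : C| * q %| #|D|)%N.
Proof.
have [g [Gg genG _ [N [oD Ng]]]] := cent_der1_cycle_comm.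
have nCG := normal_norm cent_der1_normal.
rewrite -oD dvdn_pmul2r ?cardG_gt0 //.
have [a Na] : exists a, N = (p ^ a)%N.
  have [n on] := p_natP pD; exists (logn p N).
  apply/eqP; rewrite eq_sym -p_part; apply/eqP/part_pnat_id.
  by apply: pnat_dvd pD; rewrite -oD dvdn_mulr.
have [r r1 conj_r] := der1_conjXg Gg.
have [u geomN _] := geom_pexp pr_p odd_p a r1.
have CgN : g ^+ N \in C.
  rewrite inE groupX //=; apply/centP=> d Dd; apply/commgP.
  have Gd := subsetP (der_sub 1 G) _ Dd.
  rewrite (commXg_geom _ Gg Gd conj_r) Na geomN expgM -Na -invg_comm.
  by rewrite expgVn Ng // invg1 expg1n.
have sGC : G / C \subset <[coset C g]>.
  apply/subsetP=> _ /morphimP[x Nx /genG[c Cc [i ->]] ->] /=.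
  have Ng' : g \in 'N(C) by apply: (subsetP nCG).
  have -> : coset C (c * g ^+ i) = coset C g ^+ i.
    by rewrite morphM ?Ng' ?(subsetP (normG _) _ Cc) ?groupX // morphX //= (coset_id Cc) mul1g.
  exact: mem_cycle.
rewrite -card_quotient //; apply: dvdn_trans (cardSg sGC) _.
rewrite -orderE order_dvdn -morphX ?(subsetP nCG) //.
by apply/eqP/coset_id.
Qed.

(** For a generator [[~ g, e]] of [D] with [e] in [C], the commutator [z] of [g ^+ #|G : C|] and [e]
    lies in the derived subgroup of [C]. It is the power of [[~ g, e]] with exponent [#|G : C|]
    times a number prime to [p], so [#|D|] divides [#|G : C| * #[z]]. As [#|G : C| * q] divides
    [#|D|], the order of [z] is at least [q]. *)
Lemma der1_cent_der1 : C^`(1) = 'Z(G) :&: D.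
Proof.
apply/eqP; rewrite eqEcard der1_cent_der1_sub /=.
have [e [g [Ce Gg Deg]]] := cyclic_der1_generator.
have Ge := subsetP sCG _ Ce.
have pGC : p.-nat #|G : C| by apply: pnat_dvd pG; rewrite dvdn_indexg.
have [b ob] := p_natP pGC.
have [r r1 conj_r] := der1_conjXg Gg.
have [u geomM pu] := geom_pexp pr_p odd_p b r1.
pose z := [~ g ^+ #|G : C|, e].
have C'z : z \in C^`(1).
  rewrite mem_commg // -card_quotient ?normal_norm ?cent_der1_normal //.
  apply: coset_idr; first by rewrite groupX // (subsetP (normal_norm cent_der1_normal)).
  rewrite morphX ?(subsetP (normal_norm cent_der1_normal)) //.
  by rewrite expg_cardG // mem_quotient.
have zE : z = [~ g, e] ^+ (p ^ b * u) by rewrite /z ob (commXg_geom _ Gg Ge conj_r) geomM.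
have oge : #|D| = #[[~ g, e]] by rewrite Deg -orderE -invg_comm orderV.
apply: leq_trans (dvdn_leq _ (order_dvdG C'z)); rewrite ?cardG_gt0 //.
have po : p.-nat #[z].
  by apply: mem_p_elt pG _; rewrite (subsetP (der_sub 1 G)) // (subsetP (dergS 1 sCG)).
apply: dvdn_leq; first exact: order_gt0.
have : #|D| %| p ^ b * u * #[z] by rewrite oge order_dvdn expgM -zE expg_order.
rewrite -mulnA mulnCA Gauss_dvdr; last first.
  have [n ->] := p_natP pD; case: n => [|n]; first by rewrite expn0 coprime1n.
  by rewrite coprime_pexpl // prime_coprime.
rewrite -ob => /(dvdn_trans cent_der1_index).
by rewrite dvdn_pmul2l // indexg_gt0.
Qed.

Local Notation ZD := ('Z(G) <*> D).

Lemma center_der1_sub : ZD \subset C.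
Proof.
rewrite join_subG der1_sub_cent_der1 subsetI center_sub !andbT /=.
by rewrite subIset // orbC centS ?der_sub.
Qed.

Let commute_ZD x c : x \in ZD -> c \in C -> commute x c.
Proof.
move=> ZDx Cc; suff /subsetP/(_ x ZDx)/centP : ZD \subset 'C(C) by apply.
rewrite join_subG [X in _ && X]centsC subsetIr andbT.
by rewrite subIset // orbC centS ?subsetIl.
Qed.

(** Choose [w] in [D] with [[~ c, g] ^+ q = [~ w, g]]. Then [c ^+ q * w^-1] commutes with [g], and
    also with [C], because commutators inside [C] have order dividing [q]. Since [G] is generated by
    [C] and [g], this element is central. *)
Lemma expg_cent_der1 c : c \in C -> c ^+ q \in ZD.
Proof.
have [g [Gg genG expq _]] := cent_der1_cycle_comm => Cc.
have [w Dw cgw] := expq _ (commCG Cc Gg).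
have Cw := subsetP der1_sub_cent_der1 _ Dw.
have Gc := subsetP sCG _ Cc; have Gw := subsetP sCG _ Cw.
rewrite -(mulgKV w (c ^+ q)) groupM //; last by rewrite mem_gen // inE Dw orbT.
apply: mem_gen; rewrite inE; apply/orP; left; apply/centerP.
split=> [|_ /genG[c' Cc' [i ->]]]; first by rewrite groupM ?groupX ?groupV.
have cVg : commute (c ^+ q * w^-1) g.
  apply/commgP; rewrite commMg_cent_der1 ?groupX ?groupV //.
  rewrite commVg ?commXg_cent_der1 ?cgw ?mulgV //.
  exact: cent_der1_commute (commCG Cw Gg).
apply: commuteM; last exact: commuteX.
apply: commute_sym; apply: commuteM; last first.
  by apply: commuteV; apply: cent_der1_commute.
apply: commute_sym; apply/commgP; rewrite commXg_cent_der1 ?(subsetP sCG) //.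
have : [~ c, c'] \in 'Z(G) :&: D by rewrite -der1_cent_der1 mem_commg.
by move/order_dvdG; rewrite order_dvdn.
Qed.

Let card_q : exists t, q = (p ^ t)%N.
Proof. by have [t] := p_natP (pgroupS (subsetIr _ _) pD : p.-group ('Z(G) :&: D)); exists t. Qed.

(** Here 1 = [[~ x ^+ q, c]] is the power of [[~ x, c]] with exponent [q * u], [u] prime to [p]. So
    [[~ x, c] ^+ q = 1], and in the cyclic group [D] such elements form the subgroup of order
    [q]. *)
Lemma commg_expg_center x c : x \in G -> x ^+ q \in ZD -> c \in C -> [~ x, c] \in 'Z(G) :&: D.
Proof.
move=> Gx ZDx Cc; have Gc := subsetP sCG _ Cc.
apply: (cyclic_expg_card_mem cycD); rewrite ?subsetIr ?mem_commg //.
have [t qE] := card_q; have [r r1 conj_r] := der1_conjXg Gx.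
have [u geomq pu] := geom_pexp pr_p odd_p t r1.
have := commXg_geom q Gx Gc conj_r; rewrite {2}qE geomq -qE expgM.
have /commgP/eqP -> := commute_ZD ZDx Cc => /esym/eqP.
rewrite -order_dvdn => ou.
have /p_natP[s os] : p.-elt ([~ x, c] ^+ q) by rewrite (mem_p_elt pD) ?groupX ?mem_commg.
apply/eqP; rewrite -order_eq1 os; case: s os => // s os.
by case/negP: pu; apply: dvdn_trans ou; rewrite os expnS dvdn_mulr.
Qed.

(** The converse uses the three subgroups lemma for [G], [<[x]>] and [C]: [[~: G, <[x]>]] lies in
    [D] and is centralized by [C], while [[~: <[x]>, C]] is central in [G]. Hence [x] centralizes
    [[~: C, G] = D]. *)
Lemma mem_cent_der1 x : x \in G -> (x \in C) = (x ^+ q \in ZD).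
Proof.
move=> Gx; apply/idP/idP=> [|ZDx]; first exact: expg_cent_der1.
rewrite inE Gx /= -cycle_subG centsC; apply/commG1P.
rewrite -[X in [~: X, _]]commg_cent_der1; apply: three_subgroup.
  apply/commG1P; apply: subset_trans (_ : D \subset _).
    by rewrite commgS // cycle_subG.
  by rewrite centsC subsetIr.
apply/commG1P; rewrite gen_subG; apply/subsetP=> _ /imset2P[_ c /cycleP[i ->] Cc ->].
have : x ^+ i ^+ q \in ZD by rewrite -expgM mulnC expgM groupX.
move=> ZDxi; have /setIP[/centerP[_ cxG] _] := commg_expg_center (groupX i Gx) ZDxi Cc.
by apply/centP.
Qed.

Lemma root_group_set n : group_set (root_set ZD G n).
Proof.
by apply: root_set_group_set; rewrite ?joing_subr // (subset_trans center_der1_sub).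
Qed.
Definition root_group n := Group (root_group_set n).
Local Notation Om s := (root_group (p ^ s)).

Lemma sub_root_cent_der1 s : q = (p ^ s)%N -> Om s = C :> {set gT}.
Proof.
move=> qs; apply/setP=> x; rewrite /= inE -qs; apply/andP/idP.
  by case=> Gx; rewrite mem_cent_der1.
by move=> Cx; have Gx := subsetP sCG _ Cx; rewrite Gx -mem_cent_der1.
Qed.

Lemma root_groupS s : Om s \subset Om s.+1.
Proof.
by apply/subsetP=> x; rewrite !inE expnSr expgM => /andP[-> ZDx]; rewrite groupX.
Qed.

Lemma root_group_normal s : Om s <| G.
Proof.
apply: sub_der1_normal; apply/subsetP=> x; last by rewrite inE => /andP[].
move=> Dx; rewrite inE (subsetP (der_sub 1 G)) //=.
by rewrite groupX // mem_gen // inE Dx orbT.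
Qed.

(** From [t] on, these groups contain [C], so the quotient is a section of the cyclic group [G / C];
    it is killed by [p]. *)
Lemma index_root_group_le t s : q = (p ^ t)%N -> (t <= s)%N -> (#|Om s.+1 : Om s| <= p)%N.
Proof.
move=> qt le_ts; have nOG := normal_norm (root_group_normal s).
have sCO : C \subset Om s.
  rewrite -(sub_root_cent_der1 qt); elim: s le_ts {nOG} => [|s IH].
    by rewrite leqn0 => /eqP->.
  rewrite leq_eqVlt => /orP[/eqP-> // | /IH sOt].
  exact: subset_trans sOt (root_groupS _).
have sOG : Om s.+1 \subset G by case/andP: (root_group_normal s.+1).
rewrite -card_quotient ?(subset_trans sOG) //.
have /cyclicP[x Ox] : cyclic (Om s.+1 / Om s).
  apply: cyclicS (quotientS _ sOG) _.
  have /isog_cyclic<- := third_isog sCO cent_der1_normal (root_group_normal s).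
  exact/quotient_cyclic/quo_cent_der1_cyclic.
have : x \in Om s.+1 / Om s by rewrite Ox cycle_id.
case/morphimP=> y Ny; rewrite /= inE => /andP[Gy ZDy] xE; rewrite Ox -orderE.
rewrite dvdn_leq ?prime_gt0 // order_dvdn xE -morphX //=; apply/eqP/coset_id.
by rewrite inE groupX //= -expgM -expnS.
Qed.

(** Index at most [p] would make [C] generated by [Om t] and one element [c0]. For [o] in [Om t] the
    power [o ^+ (p ^ t)] is centralized by [C], so [[~ o, c] ^+ (p ^ t) = 1], and [c0] commutes with
    itself. Then [p ^ t] would kill the derived subgroup of [C], which is cyclic of order
    [p ^ t.+1]. *)
Lemma index_root_group_gt t : q = (p ^ t.+1)%N -> (p < #|Om t.+1 : Om t|)%N.
Proof.
move=> qt; have OmC := sub_root_cent_der1 qt.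
have sOC : Om t \subset C by rewrite -OmC root_groupS.
rewrite ltnNge; apply/negP; rewrite OmC => le_p.
have sDO : D \subset Om t.
  apply/subsetP=> x Dx; rewrite inE (subsetP (der_sub 1 G)) //=.
  by rewrite groupX // mem_gen // inE Dx orbT.
have nOC : C \subset 'N(Om t) by apply: subset_trans (normal_norm (root_group_normal t)).
have cycCO : cyclic (C / Om t).
  apply: (@dvdn_prime_cyclic _ _ p) => //; rewrite card_quotient //.
  have : p.-nat #|C : Om t| by apply: pnat_dvd (dvdn_indexg _ _) (pgroupS sCG pG).
  case/p_natP=> -[|[|k]] ok; rewrite ok ?expn0 ?dvd1n ?expn1 ?dvdnn //.
  have : (p ^ 1 < p ^ k.+2)%N by rewrite ltn_exp2l ?(prime_gt1 pr_p).
  by rewrite expn1 -ok ltnNge le_p.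
have commOC x c : x \in Om t -> c \in C -> [~ x, c] ^+ (p ^ t) = 1.
  move=> Ox Cc; rewrite -commXg_cent_der1 ?(subsetP sCG _ Cc) ?(subsetP sOC) //.
  by apply/eqP/commgP/commute_ZD => //; move: Ox; rewrite inE => /andP[].
have [c0 Cc0 genC] : exists2 c0, c0 \in C &
    forall x, x \in C -> exists2 o, o \in Om t & exists i, x = o * c0 ^+ i.
  case/cyclicP: cycCO => cb Ecb.
  have /morphimP[c Nc Cc cE] : cb \in C / Om t by rewrite Ecb cycle_id.
  exists c => // x Cx; have : coset (Om t) x \in C / Om t by rewrite mem_quotient.
  rewrite Ecb => /cycleP[i]; rewrite cE -morphX // => Exi.
  have : x \in Om t :* (c ^+ i).
    by apply/rcoset_kercosetP; rewrite ?(subsetP nOC) ?groupX.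
  by case/rcosetP=> o Oo ->; exists o => //; exists i.
have cC' x y : x \in C^`(1) -> y \in C^`(1) -> commute x y.
  move=> C'x C'y; apply: (centsP cDD).
    exact: (subsetP (dergS 1 sCG)).
  exact: (subsetP (dergS 1 sCG)).
have commC x y : x \in C -> y \in C -> [~ x, y] ^+ (p ^ t) = 1.
  move=> Cx Cy; have [o Oo [i ->]] := genC _ Cx; have [o' Oo' [j ->]] := genC _ Cy.
  have [Co Co'] := (subsetP sOC _ Oo, subsetP sOC _ Oo').
  have Cy' : o' * c0 ^+ j \in C by rewrite groupM ?groupX.
  rewrite commMg_cent_der1 ?groupX ?(subsetP sCG _ Cy') //.
  rewrite expgMn; last by apply: cC'; rewrite mem_commg ?groupX.
  rewrite commOC // mul1g commXg_cent_der1 ?(subsetP sCG _ Cy') //.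
  rewrite -expgM mulnC expgM -invg_comm expgVn.
  rewrite commMg_cent_der1 ?groupX ?(subsetP sCG _ Cc0) //.
  rewrite expgMn; last by apply: cC'; rewrite mem_commg ?groupX.
  rewrite commOC // mul1g commXg_cent_der1 ?(subsetP sCG _ Cc0) //.
  by rewrite commgg expg1n expg1n invg1 expg1n.
have sC'R : C^`(1) \subset root_set 1 D (p ^ t).
  have gR : group_set (root_set 1 D (p ^ t)).
    by apply: (@root_set_group_set _ 1%G [group of D]); rewrite ?sub1G // (derG1P cDD).
  rewrite (gen_subG _ (Group gR)); apply/subsetP=> _ /imset2P[x y Cx Cy ->].
  by rewrite inE commCG ?(subsetP sCG) //=; apply/set1P/commC.
have /cyclicP[z C'z] : cyclic C^`(1) by apply: cyclicS (dergS 1 sCG) cycD.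
have := subsetP sC'R z; rewrite C'z cycle_id => /(_ isT).
rewrite inE => /andP[_ /set1P/eqP]; rewrite -order_dvdn orderE -C'z der1_cent_der1 qt.
by rewrite dvdn_Pexp2l ?prime_gt1 // ltnn.
Qed.

Local Notation U j := (mhoP p j C).

(** Powers already form a group: [C] has class at most 2, so [(c * d) ^+ N] is [c ^+ N * d ^+ N]
    times [[~ d, c]] to the power ['C(N, 2)]. For odd [N = p ^ j] this exponent is a multiple
    [m * N], and the correction is absorbed into the base. *)
Lemma mem_mho_cent_der1 j x : (x \in U j) = (x \in [set c ^+ (p ^ j) | c in C]).
Proof.
suff gU : group_set [set c ^+ (p ^ j) | c in C].
  by rewrite /mhoP gen_set_id.
apply/group_setP; split; first by apply/imsetP; exists 1; rewrite ?group1 ?expg1n.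
move=> _ _ /imsetP[c Cc ->] /imsetP[d Cd ->].
have /dvdnP[m hm] : (p ^ j %| 'C(p ^ j, 2))%N.
  by rewrite bin2odd ?dvdn_mulr ?dvdnn // oddX odd_p orbT.
have Gd := subsetP sCG _ Cd; have Cdc := subsetP der1_sub_cent_der1 _ (commCG Cd (subsetP sCG _ Cc)).
have ZDdc : [~ d, c] \in D by apply: commCG => //; apply: (subsetP sCG).
have cx y : y \in C -> commute y [~ d, c] by move=> Cy; apply: cent_der1_commute.
apply/imsetP; exists (c * d * [~ d, c] ^- m); first by rewrite !groupM ?groupV ?groupX.
rewrite expgMn; last first.
  by apply: commuteV; apply: commuteX; apply: cx; rewrite groupM.
by rewrite (expMg_Rmul _ (cx d Cd) (cx c Cc)) expgVn -expgM -hm mulgK.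
Qed.

Lemma mhoP_cent_der1 j x : reflect (exists2 c, c \in C & x = c ^+ (p ^ j)) (x \in U j).
Proof. by rewrite mem_mho_cent_der1; apply: imsetP. Qed.

Lemma mho_cent_der1_norm j : G \subset 'N(U j).
Proof.
apply/subsetP=> g Gg; rewrite inE; apply/subsetP=> _ /imsetP[x Ux ->].
have [c Cc ->] := mhoP_cent_der1 _ _ Ux; apply/mhoP_cent_der1.
exists (c ^ g); last by rewrite conjXg.
by rewrite memJ_norm // (subsetP (normal_norm cent_der1_normal)).
Qed.

(** Collecting gives [(h * c) ^+ n] as [h ^+ n * c ^+ n] times a power of [[~ c, h]], whose exponent
    is the sum of the [geom r i] for [i < n]. For [n = p ^ j] it is divisible by [p ^ j], so that
    factor lies in [U j] too. *)
Lemma expMg_cent_der1 h c j : h \in G -> c \in C ->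
  exists2 u, u \in U j & (h * c) ^+ (p ^ j) = h ^+ (p ^ j) * u.
Proof.
move=> Gh Cc; have Gc := subsetP sCG _ Cc.
have [r r1 conj_r] := der1_conjXg Gh.
have Dch := commCG Cc Gh; have Cch := subsetP der1_sub_cent_der1 _ Dch.
have expM n : (h * c) ^+ n = h ^+ n * c ^+ n * [~ c, h] ^+ (\sum_(i < n) geom r i).
  elim: n => [|n IH]; first by rewrite big_ord0 !mulg1.
  have -> : (\sum_(i < n.+1) geom r i = n + r * \sum_(i < n) geom r i)%N.
    rewrite big_ord_recl /= {1}/geom big_ord0 add0n big_distrr /=.
    rewrite -[X in (X + _)%N](card_ord n) -sum1_card -big_split /=; apply: eq_bigr => i _.
    by rewrite /bump /= [LHS](geomD r 1) expn1 {1}/geom big_ord1.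
  have ccd : commute c [~ c, h] by apply: cent_der1_commute.
  rewrite [LHS]expgSr {}IH; set T := (\sum_(i < n) _)%N.
  have key : c ^+ n * [~ c, h] ^+ T * h = h * (c ^+ n * [~ c, h] ^+ n * [~ c, h] ^+ (r * T)).
    by rewrite conjgC conjMg !conjXg (conj_r _ Dch) -expgM [c ^ h]conjg_mulR expgMn.
  rewrite -[h ^+ n * _ * _]mulgA [LHS]mulgA -[_ * _ * h]mulgA key.
  rewrite [h ^+ n.+1]expgSr [c ^+ n.+1]expgSr -!mulgA; congr (_ * (_ * (_ * _))).
  by rewrite mulgA -expgD; apply/esym/commuteX/ccd.
exists (c ^+ (p ^ j) * [~ c, h] ^+ (\sum_(i < p ^ j) geom r i)); last by rewrite mulgA expM.
have /dvdnP[m ->] := dvdn_sum_geom pr_p odd_p j r1.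
rewrite /mhoP groupM // ?expgM; apply/mhoP_cent_der1; first by exists c.
by exists ([~ c, h] ^+ m); rewrite ?groupX.
Qed.
End CyclicDerived.

(** * The group algebra as a ring *)

(** A separate name keeps convolution, not the pointwise product, as the ring multiplication. *)
Definition galg (k : fieldType) (T : finGroupType) : Type := gfun k T.
HB.instance Definition _ (k : fieldType) (T : finGroupType) :=
  GRing.Zmodule.copy (galg k T) (gfun k T).

Section GroupAlgebraRing.
Local Open Scope ring_scope.
Variables (k : fieldType) (T : finGroupType).
Local Notation A := (galg k T).
Implicit Types (a b c : A) (x : k).

Definition gmul a b : A := gconv a b.
Definition gone : A := gdelta k 1%g.

Lemma gmulE a b z : gmul a b z = \sum_x a x * b (x^-1 * z)%g.
Proof. by rewrite ffunE. Qed.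

Lemma gmulA : associative gmul.
Proof.
move=> a b c; apply/ffunP=> z; rewrite !gmulE.
under eq_bigr do rewrite gmulE big_distrr.
under [RHS]eq_bigr do rewrite gmulE big_distrl.
rewrite [RHS]exchange_big /=; apply: eq_bigr => x _.
rewrite [RHS](reindex_inj (mulgI x)) /=; apply: eq_bigr => y _.
by rewrite mulKg mulrA invMg mulgA.
Qed.

Lemma gmul1 : left_id gone gmul.
Proof.
move=> a; apply/ffunP=> z; rewrite gmulE (bigD1 1%g) //= big1 => [|x /negPf x1].
  by rewrite ffunE eqxx mul1r invg1 mul1g addr0.
by rewrite ffunE x1 mul0r.
Qed.

Lemma gmulr1 : right_id gone gmul.
Proof.
move=> a; apply/ffunP=> z; rewrite gmulE (bigD1 z) //= big1 => [|x xz].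
  by rewrite mulVg ffunE eqxx mulr1 addr0.
by rewrite ffunE -eq_invg_mul invgK (negPf xz) mulr0.
Qed.

Lemma gmulDl : left_distributive gmul +%R.
Proof.
move=> a b c; apply/ffunP=> z; rewrite !(gmulE, ffunE) -big_split /=.
by apply: eq_bigr => x _; rewrite ffunE mulrDl.
Qed.

Lemma gmulDr : right_distributive gmul +%R.
Proof.
move=> a b c; apply/ffunP=> z; rewrite !(gmulE, ffunE) -big_split /=.
by apply: eq_bigr => x _; rewrite ffunE mulrDr.
Qed.

Lemma gone_neq0 : gone != 0.
Proof.
by apply/eqP=> /ffunP/(_ 1%g); rewrite !ffunE eqxx => /eqP; rewrite oner_eq0.
Qed.

HB.instance Definition _ :=
  GRing.Zmodule_isNzRing.Build A gmulA gmul1 gmulr1 gmulDl gmulDr gone_neq0.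

Lemma gscaleA x y a : gscale x (gscale y a) = gscale (x * y) a.
Proof. by apply/ffunP=> z; rewrite !ffunE mulrA. Qed.
Lemma gscale1 : left_id 1 (@gscale k T).
Proof. by move=> a; apply/ffunP=> z; rewrite !ffunE mul1r. Qed.
Lemma gscaleDr : right_distributive (@gscale k T) +%R.
Proof. by move=> x a b; apply/ffunP=> z; rewrite !ffunE mulrDr. Qed.
Lemma gscaleDl (a : gfun k T) : {morph (@gscale k T)^~ a : x y / x + y}.
Proof. by move=> x y; apply/ffunP=> z; rewrite !ffunE mulrDl. Qed.

HB.instance Definition _ :=
  GRing.Zmodule_isLmodule.Build k A gscaleA gscale1 gscaleDr gscaleDl.

Lemma gscaleAl x a b : x *: (a * b) = x *: a * b.
Proof.
apply/ffunP=> z; rewrite ![in LHS]ffunE [RHS]gmulE big_distrr /=.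
by apply: eq_bigr => y _; rewrite ffunE mulrA.
Qed.
HB.instance Definition _ := GRing.Lmodule_isLalgebra.Build k A gscaleAl.
Lemma gscaleAr x a b : x *: (a * b) = a * (x *: b).
Proof.
apply/ffunP=> z; rewrite ![in LHS]ffunE [RHS]gmulE big_distrr /=.
by apply: eq_bigr => y _; rewrite ffunE mulrCA.
Qed.
HB.instance Definition _ := GRing.Lalgebra_isAlgebra.Build k A gscaleAr.

Definition gd (g : T) : A := gdelta k g.

Lemma gscaleE x a g : (x *: a) g = x * a g.
Proof. by rewrite ffunE. Qed.

Lemma gaddE a b g : (a + b) g = a g + b g.
Proof. by rewrite ffunE. Qed.

Lemma gsumE (I : Type) (r : seq I) (P : pred I) (F : I -> A) g :
  (\sum_(i <- r | P i) F i) g = \sum_(i <- r | P i) F i g.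
Proof. by elim/big_rec2: _ => [|i y a _ <-]; rewrite ffunE. Qed.

Lemma gdE g (x : T) : gd g x = (x == g)%:R.
Proof. by rewrite ffunE. Qed.

Lemma galg_mulE a b z : (a * b) z = \sum_x a x * b (x^-1 * z)%g.
Proof. exact: gmulE. Qed.

Lemma gd1 : gd 1%g = 1. Proof. by []. Qed.

Lemma mul_gdE g b (x : T) : (gd g * b) x = b (g^-1 * x)%g.
Proof.
rewrite [LHS]gmulE (bigD1 g) //= big1 => [|y /negPf yg]; rewrite ?gdE.
  by rewrite eqxx mul1r addr0.
by rewrite yg mul0r.
Qed.

Lemma gmul_gdE a g (x : T) : (a * gd g) x = a (x * g^-1)%g.
Proof.
rewrite [LHS]gmulE (bigD1 (x * g^-1)%g) //= big1 => [|y yg].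
  by rewrite gdE invMg invgK mulgKV eqxx mulr1 addr0.
rewrite gdE; case: (_ =P g) yg => [<-|]; rewrite ?mulr0 //.
by rewrite invMg invgK mulKVg eqxx.
Qed.

Lemma gdM g h : gd (g * h) = gd g * gd h.
Proof. by apply/ffunP=> x; rewrite mul_gdE !gdE; congr (nat_of_bool _)%:R;
  apply/eqP/eqP=> [->|<-]; rewrite ?mulKg ?mulKVg. Qed.

Lemma gdX g n : gd (g ^+ n) = gd g ^+ n.
Proof. by elim: n => // n IH; rewrite expgS gdM IH exprS. Qed.

Lemma galg_sum a : a = \sum_g a g *: gd g.
Proof.
apply/ffunP=> x; rewrite gsumE (bigD1 x) //= big1 => [|y /negPf yx].
  by rewrite gscaleE gdE eqxx mulr1 addr0.
by rewrite gscaleE gdE eq_sym yx mulr0.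
Qed.
End GroupAlgebraRing.

(** * Relative augmentation ideals *)

Inductive ideal_gen (R : nzRingType) (P : R -> Prop) : R -> Prop :=
| ideal_gen_mem x of P x : ideal_gen P x
| ideal_gen0 : ideal_gen P 0%R
| ideal_genD x y of ideal_gen P x & ideal_gen P y : ideal_gen P (x + y)%R
| ideal_genMl r x of ideal_gen P x : ideal_gen P (r * x)%R
| ideal_genMr r x of ideal_gen P x : ideal_gen P (x * r)%R.

Record is_ideal (R : nzRingType) (I : R -> Prop) : Prop := IsIdeal {
  is_ideal0 : I 0%R;
  is_idealD : forall x y, I x -> I y -> I (x + y)%R;
  is_idealMl : forall r x, I x -> I (r * x)%R;
  is_idealMr : forall r x, I x -> I (x * r)%R }.

Section IdealGen.
Local Open Scope ring_scope.
Variable (R : nzRingType).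

Lemma ideal_gen_ideal (P : R -> Prop) : is_ideal (ideal_gen P).
Proof. by split; [exact: ideal_gen0 | exact: ideal_genD | exact: ideal_genMl | exact: ideal_genMr]. Qed.

Lemma ideal_gen_min (P I : R -> Prop) : is_ideal I ->
  (forall x, P x -> I x) -> forall x, ideal_gen P x -> I x.
Proof. by case=> I0 ID IMl IMr sPI x; elim=> *; auto. Qed.

Lemma ideal_gen_morph (S : nzRingType) (f : R -> S) (P : R -> Prop) (Q : S -> Prop) :
  f 0 = 0 -> {morph f : x y / x + y} -> {morph f : x y / x * y} ->
  (forall x, P x -> ideal_gen Q (f x)) -> forall x, ideal_gen P x -> ideal_gen Q (f x).
Proof.
move=> f0 fD fM fP x; elim=> *; rewrite ?f0 ?fD ?fM; auto.
- exact: ideal_gen0.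
- exact: ideal_genD.
- exact: ideal_genMl.
- exact: ideal_genMr.
Qed.

Section Closure.
Variables (I : R -> Prop) (idI : is_ideal I).
Lemma is_idealN x : I x -> I (- x).
Proof. by move=> Ix; rewrite -mulN1r; apply: is_idealMl. Qed.
Lemma is_idealB x y : I x -> I y -> I (x - y).
Proof. by move=> Ix Iy; apply: is_idealD => //; apply: is_idealN. Qed.
Lemma is_ideal_sum (J : Type) (r : seq J) (Q : pred J) (F : J -> R) :
  (forall i, Q i -> I (F i)) -> I (\sum_(i <- r | Q i) F i).
Proof. by move=> IF; elim/big_ind: _ => //; [apply: is_ideal0 | apply: is_idealD]. Qed.
End Closure.
End IdealGen.

Section RelAug.
Local Open Scope group_scope.
Local Open Scope ring_scope.
Variables (k : fieldType) (T : finGroupType).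
Local Notation A := (galg k T).
Local Notation gd := (@gd k T).
Implicit Types (a b c : A) (N M : {group T}).

(* [relI N] is the right ideal I(N)kT: its elements are those whose sums over all
   right cosets of N vanish, see [rel_aug_idealP]. *)
Definition csum (N : {set T}) (a : A) (x : T) : k := \sum_(y in N) a (y * x)%g.
Definition relI (N : {set T}) (a : A) : Prop := forall x, csum N a x = 0.

Lemma csumD N a b x : csum N (a + b) x = csum N a x + csum N b x.
Proof. by rewrite -big_split; apply: eq_bigr => y _; rewrite gaddE. Qed.

Lemma csumZ N r a x : csum N (r *: a) x = r * csum N a x.
Proof. by rewrite [RHS]big_distrr; apply: eq_bigr => y _; rewrite gscaleE. Qed.

Lemma csumM N a b x : csum N (a * b) x = \sum_w csum N a w * b (w^-1 * x)%g.
Proof.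
under [RHS]eq_bigr do rewrite big_distrl.
rewrite exchange_big /=; apply: eq_bigr => y _.
rewrite galg_mulE (reindex_inj (mulgI y)) /=; apply: eq_bigr => w _.
by rewrite invMg mulgA mulgKV.
Qed.

Lemma csumMl N a b x : (N <| [set: T])%g -> csum N (b * a) x = \sum_w b w * csum N a (w^-1 * x)%g.
Proof.
move=> nNT; rewrite /csum; under eq_bigr => y _ do rewrite galg_mulE.
rewrite exchange_big; apply: eq_bigr => w _; rewrite -big_distrr; congr (_ * _).
have wN : w \in 'N(N)%g by rewrite (subsetP (normal_norm nNT)) ?inE.
rewrite (reindex_inj (conjg_inj w^-1%g)) /=; apply: eq_big => [y|y _].
  by rewrite memJ_norm ?groupV.
by rewrite conjgE invgK !mulgA mulVg mul1g.
Qed.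

Lemma csum_gd N g x : csum N (gd g) x = (x \in N :* g)%:R.
Proof.
rewrite /csum mem_rcoset; have [Nxg | Nxg] := boolP (_ \in N).
  rewrite (bigD1 (x * g^-1)^-1)%g /= ?groupV // big1 => [|y /andP[_ yxg]]; rewrite gdE.
    by rewrite invMg invgK mulgKV eqxx addr0.
  by case: (_ =P g) yxg => // <-; rewrite invMg invgK mulgK eqxx.
rewrite big1 // => y Ny; rewrite gdE; case: eqP => // yx; case/negP: Nxg.
by rewrite -yx invMg mulKVg groupV.
Qed.

Lemma csum_mulN N a y x : y \in N -> csum N a (y * x)%g = csum N a x.
Proof.
move=> Ny; rewrite /csum [RHS](reindex_inj (mulIg y)) /=.
by apply: eq_big => [z|z _]; rewrite ?groupMr // mulgA.
Qed.

Lemma relI0 N : relI N 0.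
Proof. by move=> x; rewrite /csum big1 // => y _; rewrite ffunE. Qed.
Lemma relID N a b : relI N a -> relI N b -> relI N (a + b).
Proof. by move=> Ia Ib x; rewrite csumD Ia Ib addr0. Qed.
Lemma relIZ N r a : relI N a -> relI N (r *: a).
Proof. by move=> Ia x; rewrite csumZ Ia mulr0. Qed.
Lemma relIMr N b a : relI N a -> relI N (a * b).
Proof. by move=> Ia x; rewrite csumM big1 // => w _; rewrite Ia mul0r. Qed.
Lemma relIMl N b a : (N <| [set: T])%g -> relI N a -> relI N (b * a).
Proof. by move=> nN Ia x; rewrite csumMl // big1 // => w _; rewrite Ia mulr0. Qed.

Lemma relI_ideal N : (N <| [set: T])%g -> is_ideal (relI N).
Proof.
by move=> nN; split; [exact: relI0 | exact: relID | move=> *; exact: relIMl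
  | move=> *; exact: relIMr].
Qed.

Lemma relI_gd1 N g : relI N (gd g - 1) <-> g \in N.
Proof.
have csumB x : csum N (gd g - 1) x = (x \in N :* g)%:R - (x \in N)%:R.
  by rewrite -scaleN1r csumD csumZ !csum_gd mulN1r mulg1.
split=> [/(_ 1%g)|Ng x]; rewrite csumB.
  rewrite group1 mem_rcoset mul1g groupV; case: (g \in N) => //.
  by move/eqP; rewrite sub0r oppr_eq0 oner_eq0.
by rewrite rcoset_id // subrr.
Qed.

(** The right side is [a] minus the sum of the [a x *: gd (repr (N :* x))]. The coefficient of the
    latter at a representative is the coset sum of [a], which vanishes. *)
Lemma relI_sum N a : relI N a ->
  a = \sum_x a x *: ((gd (x * (repr (N :* x))^-1)%g - 1) * gd (repr (N :* x))).
Proof.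
move=> Ia; pose r x := repr (N :* x).
have rE x y : (r y == x) = (r x == x) && (y \in N :* x).
  apply/eqP/andP=> [<-|[/eqP rx /rcoset_eqP Nyx]]; last by rewrite /r Nyx.
  have Nyr : r y \in N :* y by apply: mem_repr_rcoset.
  rewrite rcoset_sym Nyr; split=> //.
  by rewrite {1}/r (rcoset_eqP Nyr).
have -> : \sum_x a x *: ((gd (x * (r x)^-1)%g - 1) * gd (r x)) =
   a - \sum_x a x *: gd (r x).
  rewrite {2}(galg_sum a) -sumrB; apply: eq_bigr => x _.
  by rewrite mulrBl mul1r -gdM mulgKV scalerBr.
suff -> : \sum_x a x *: gd (r x) = 0 by rewrite subr0.
apply/ffunP=> x; rewrite gsumE [RHS]ffunE.
under eq_bigr do rewrite gscaleE gdE eq_sym rE mulr_natr mulrb.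
rewrite -big_mkcond /=; case: (r x == x); last by rewrite big_pred0.
rewrite /= -[RHS](Ia x) /csum [LHS](reindex_inj (mulIg x)) /=.
by apply: eq_bigl => y; rewrite mem_rcoset mulgK.
Qed.

Lemma relI_ind N (P : A -> Prop) : P 0 -> (forall a b, P a -> P b -> P (a + b)) ->
  (forall n b, n \in N -> P ((gd n - 1) * b)) -> forall a, relI N a -> P a.
Proof.
move=> P0 PD PN a /relI_sum ->; elim/big_ind: _ => // x _.
rewrite scalerAr; apply: PN; rewrite -mem_rcoset rcoset_sym; exact: mem_repr_rcoset.
Qed.

Lemma relI_gen_ind (S : {set T}) (P : A -> Prop) : P 0 -> (forall a b, P a -> P b -> P (a + b)) ->
  (forall n b, n \in S -> P ((gd n - 1) * b)) -> forall a, relI <<S>>%g a -> P a.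
Proof.
move=> P0 PD PS; apply: relI_ind => // n b Sn; move: b.
case/gen_prodgP: Sn => m [s Ss ->].
elim: m s Ss => [|m IH] s Ss b; first by rewrite big_ord0 gd1 subrr mul0r.
rewrite big_ord_recl gdM.
have -> (u v : A) : (u * v - 1) * b = (u - 1) * (v * b) + (v - 1) * b.
  by rewrite !mulrBl !mul1r mulrA addrA subrK.
by apply: PD; [apply: PS | apply: IH].
Qed.

Lemma relI_subset N M a : N \subset M -> relI N a -> relI M a.
Proof.
move=> sNM; move: a; apply: relI_ind; [exact: relI0 | exact: relID |].
by move=> n b Nn; apply/relIMr/relI_gd1/(subsetP sNM).
Qed.

Lemma relI_sub N M : (forall a, relI N a -> relI M a) -> N \subset M.
Proof. by move=> sI; apply/subsetP=> n Nn; apply/relI_gd1/sI/relI_gd1. Qed.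

(** Both inclusions rest on gh - hg = hg([g, h] - 1), with hg a unit. *)
Lemma relI_der1_comm a : ideal_gen (fun v => exists b c, v = b * c - c * b) a <->
  relI [set: T]^`(1)%g a.
Proof.
have nD : ([set: T]^`(1) <| [set: T])%g := der_normal 1 _.
have idD := relI_ideal nD; split.
  apply: (ideal_gen_min idD) => _ [b [c ->]].
  rewrite (galg_sum b) mulr_suml mulr_sumr -sumrB; apply: (is_ideal_sum idD) => g _.
  rewrite (galg_sum c) mulr_suml mulr_sumr -sumrB; apply: (is_ideal_sum idD) => h _.
  rewrite -!scalerAl -!scalerAr scalerA [X in _ - X]scalerA [b g * _]mulrC -scalerBr.
  apply: relIZ; rewrite -!gdM.
  have -> : (g * h = h * g * [~ g, h])%g by rewrite commgC.
  rewrite [gd (_ * [~ _, _])]gdM -{2}[gd (h * g)]mulr1 -mulrBr.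
  by apply/relIMl/relI_gd1/mem_commg; rewrite ?inE.
apply: relI_gen_ind; [exact: ideal_gen0 | exact: ideal_genD |].
move=> _ b /imset2P[g h _ _ ->]; apply: ideal_genMr.
have -> : gd [~ g, h] - 1 = gd (h * g)^-1%g * (gd g * gd h - gd h * gd g).
  by rewrite mulrBr -!gdM mulVg gd1 (commgC g h) mulKg.
by apply/ideal_genMl/ideal_gen_mem; exists (gd g), (gd h).
Qed.

Lemma gaugD a b : gaug (a + b) = gaug a + gaug b.
Proof. by rewrite /gaug -big_split; apply: eq_bigr => x _; rewrite gaddE. Qed.

Lemma gaugZ (c : k) a : gaug (c *: a) = c * gaug a.
Proof. by rewrite /gaug big_distrr; apply: eq_bigr => x _; rewrite gscaleE. Qed.

Lemma gaugM a b : gaug (a * b) = gaug a * gaug b.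
Proof.
rewrite /gaug big_distrl /=; under eq_bigr do rewrite galg_mulE.
rewrite exchange_big; apply: eq_bigr => x _; rewrite -big_distrr; congr (_ * _).
by rewrite (reindex_inj (mulgI x)); apply: eq_bigr => y _; rewrite mulKg.
Qed.

Lemma gaug_gd g : gaug (gd g) = 1.
Proof.
rewrite /gaug (bigD1 g) //= big1 => [|x /negPf xg]; first by rewrite gdE eqxx addr0.
by rewrite gdE xg.
Qed.

Lemma gaugX a n : gaug (a ^+ n) = gaug a ^+ n.
Proof. by elim: n => [|n IH]; rewrite ?gaug_gd // !exprS gaugM IH. Qed.

Lemma gaugB a b : gaug (a - b) = gaug a - gaug b.
Proof. by rewrite -scaleN1r gaugD gaugZ mulN1r. Qed.
End RelAug.

(** * p-th powers of sums in filtered rings *)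

Section Jacobson.
Local Open Scope ring_scope.

Definition rcomm (R : nzRingType) (u v : R) : R := u * v - v * u.

Section Recurrence.
Variables (R : nzRingType) (u c : R) (d : nat -> R).
Hypotheses (d0 : d 0 = 0) (dS : forall n, d n.+1 = u * d n + c * u ^+ n).

(** Two sequences satisfy the recurrence: the derivatives of [u ^+ n] for a polynomial [u], with [c]
    its derivative, and the commutators of [u ^+ n] with [v], with [c = rcomm u v]. The closed form
    follows from Pascal's rule after moving [u] past the iterated commutators. *)
Lemma derivation_expand n :
  d n = \sum_(j < n) (iter j (rcomm u) c * u ^+ (n.-1 - j)) *+ 'C(n, j.+1).
Proof.
elim: n => [|n IH]; first by rewrite big_ord0.
pose w i := iter i (rcomm u) c.
have wS i : u * w i = w i.+1 + w i * u by rewrite {2}/w iterS -/(w i) /rcomm subrK.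
rewrite dS {}IH /= mulr_sumr.
under [X in X + _ = _]eq_bigr => j _ do
  rewrite mulrnAr mulrA -/(w j) wS mulrDl mulrnDl -[w j * u * _]mulrA -exprS.
rewrite big_split /= -addrA addrCA.
under [RHS]eq_bigr => j _ do rewrite -/(w j) binS mulrnDr.
rewrite big_split /=; congr (_ + _).
  rewrite [RHS]big_ord_recr /= bin_small // mulr0n addr0.
  apply: eq_bigr => i _; case: n i => [[]//|n i]; congr (_ * _ ^+ _ *+ _).
  by rewrite /= subSn // -ltnS.
rewrite [RHS]big_ord_recl /= subn0 bin0 mulr1n addrC; congr (_ + _).
by apply: eq_bigr => -[i /= _] _; rewrite /bump /= add1n subnS predn_sub.
Qed.

Lemma derivation_pchar p : p \in [pchar R] -> d p = iter p.-1 (rcomm u) c.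
Proof.
move=> pcR; have pr_p := pcharf_prime pcR; rewrite derivation_expand.
case: p pr_p pcR => // p pr_p pcR.
rewrite big_ord_recr /= subnn expr0 mulr1 binn mulr1n big1 ?add0r // => j _.
by rewrite -mulr_natr (bin_lt_pcharf_0 pcR) ?mulr0 //= ltnS ltn_ord.
Qed.
End Recurrence.

Lemma rcomm_exp_pchar (R : nzRingType) p (u v : R) : p \in [pchar R] ->
  rcomm (u ^+ p) v = iter p (rcomm u) v.
Proof.
move=> pcR; have p0 := prime_gt0 (pcharf_prime pcR).
pose d n := rcomm (u ^+ n) v.
have d0 : d 0%N = 0 by rewrite /d /rcomm mul1r mulr1 subrr.
have dS n : d n.+1 = u * d n + rcomm u v * u ^+ n.
  by rewrite /d /rcomm exprS mulrBr mulrBl !mulrA addrA subrK.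
by rewrite -[LHS]/(d p) (derivation_pchar d0 dS pcR) -iterSr prednK.
Qed.

Section Filtered.
Variables (R : nzRingType) (p : nat).
Hypothesis pcR : p \in [pchar R].
Let pr_p : prime p := pcharf_prime pcR.

Section JacobsonFormula.
Variables (F : nat -> R -> Prop) (a b : R) (s s' : nat).
Hypotheses (F0 : forall i, F i 0) (FB : forall i x y, F i x -> F i y -> F i (x - y)).
Hypotheses (ad_a : forall i x, F i x -> F (i + s)%N (rcomm a x)).
Hypotheses (ad_b : forall i x, F i x -> F (i + s)%N (rcomm b x)).
Hypothesis Fab : F s' (rcomm a b).

Let FD i x y : F i x -> F i y -> F i (x + y).
Proof. by move=> Fx Fy; rewrite -[y]opprK -[- y]sub0r; do 2 apply: FB => //. Qed.
Let FMn i x n : F i x -> F i (x *+ n).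
Proof. by move=> Fx; elim: n => [|n IH]; rewrite ?mulr0n // mulrS; apply: FD. Qed.

Let u : {poly R} := a%:P * 'X + b%:P.

Let coef_ul v n : (u * v)`_n = a * (if n == 0%N then 0 else v`_n.-1) + b * v`_n.
Proof.
by rewrite mulrDl -mulrA -commr_polyX coefD !coefCM coefMX.
Qed.

Let coef_ur v n : (v * u)`_n = (if n == 0%N then 0 else v`_n.-1) * a + v`_n * b.
Proof.
rewrite mulrDr mulrA coefD !coefMC coefMX; congr (_ + _).
by case: (n == 0%N); rewrite ?mul0r ?coefMC.
Qed.

(* Jacobson's formula for (a + b)^p, read off from the derivative of the
   polynomial (aX + b)^p, which is the (p-1)-fold commutator of aX + b with a. *)
Lemma jacobson_filtered : F (s' + (p - 2) * s)%N ((a + b) ^+ p - a ^+ p - b ^+ p).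
Proof.
have p2 := prime_gt1 pr_p.
have u' : u^`() = a%:P by rewrite /u derivMXaddC derivC mul0r addr0.
have derivu : (u ^+ p)^`() = iter p.-1 (rcomm u) a%:P.
  apply: (derivation_pchar (d := fun n => (u ^+ n)^`())); last by rewrite pchar_poly.
    by rewrite /= expr0 derivC.
  by move=> n /=; rewrite exprS derivM u' addrC.
have Fiter m n : F (s' + m * s)%N (iter m.+1 (rcomm u) a%:P)`_n.
  elim: m n => [|m IH] n.
    rewrite mul0n addn0 /= /rcomm coefB coef_ul coef_ur !coefC.
    case: n => [|n] /=; first by rewrite mulr0 mul0r !add0r -[_ - _]opprB -sub0r; apply: FB.
    case: n => [|n] /=; last by rewrite !mulr0 !mul0r !subrr.
    by rewrite !mulr0 !mul0r !addr0 subrr.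
  rewrite iterS /rcomm coefB coef_ul coef_ur -/(rcomm u).
  rewrite mulSnr addnA opprD addrACA; apply: FD; last exact: ad_b.
  by case: eqP => _; [apply: ad_a | apply: ad_a].
(* The derivative controls only [n] times the coefficient of degree [n]; for [0 < n < p] the factor
   is undone by an inverse modulo [p]. *)
have Fu n : (0 < n < p)%N -> F (s' + (p - 2) * s)%N (u ^+ p)`_n.
  case: n => // n /= np.
  have := Fiter (p - 2)%N n.
  have -> : (p - 2).+1 = p.-1 by lia.
  rewrite -derivu coef_deriv => Fn.
  have /eqP cop : coprime n.+1 p by rewrite coprime_sym prime_coprime // gtnNdvd.
  have [w v hw _] := @egcdnP n.+1 p isT.
  have p0 x : x *+ p = 0 :> R by rewrite -mulr_natr (pcharf0 pcR) mulr0.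
  have -> : (u ^+ p)`_n.+1 = (u ^+ p)`_n.+1 *+ n.+1 *+ w.
    by rewrite -mulrnA mulnC hw cop mulrnDr mulrnA p0 mulr1n add0r.
  exact: FMn.
have top n : (u ^+ n)`_n = a ^+ n /\ (forall i, (n < i)%N -> (u ^+ n)`_i = 0).
  elim: n => [|n [IHa IH0]].
    by rewrite expr0 coef1; split=> // -[|i]; rewrite ?ltnn // coef1.
  rewrite exprS; split=> [|[|i] // lt_ni].
    by rewrite coef_ul /= IHa IH0 // mulr0 addr0 exprS.
  by rewrite coef_ul /= !IH0 ?mulr0 ?addr0 // ltnW.
have bot n : (u ^+ n)`_0 = b ^+ n.
  by elim: n => [|n IH]; rewrite ?expr0 ?coef1 // exprS coef_ul /= mulr0 add0r IH exprS.
have u1 n : (u ^+ n).[1] = (a + b) ^+ n.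
  elim: n => [|n IH]; first by rewrite !expr0 hornerC.
  rewrite exprS hornerM_comm ?IH; last by rewrite /comm_poly mul1r mulr1.
  by rewrite /u hornerD hornerMX !hornerC mulr1 exprS.
(* Evaluation at 1 turns [(a + b) ^+ p] into the sum of all coefficients; the extreme ones are
   [a ^+ p] and [b ^+ p]. *)
have := @horner_coef_wide _ p.+1 (u ^+ p) 1; rewrite u1 => ->; last first.
  by apply/leq_sizeP => i; have [_] := top p; apply.
have [ap _] := top p; rewrite -(big_mkord xpredT (fun i => (u ^+ p)`_i * 1 ^+ i)).
rewrite big_nat_recr //= ap expr1n mulr1 addrK big_ltn ?prime_gt0 //.
rewrite bot expr0 mulr1 [X in F _ X]addrC addKr big_nat.
elim/big_ind: _ => [|x y Fx Fy|i ip]; [exact: F0 | exact: FD |].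
by rewrite expr1n mulr1; apply: Fu; lia.
Qed.
End JacobsonFormula.

Record filtration (F : nat -> R -> Prop) : Prop := Filtration {
  fil_top : forall x, F 0%N x;
  fil_ideal : forall i, is_ideal (F i);
  fil_anti : forall i x, F i.+1 x -> F i x;
  filM : forall i j x y, F i x -> F j y -> F (i + j)%N (x * y);
  fil_comm : forall i j x y, F i x -> F j y -> F (i + j).+1 (rcomm x y) }.

Variables (F : nat -> R -> Prop) (filF : filtration F).

Lemma fil_le i j x : (i <= j)%N -> F j x -> F i x.
Proof. by move/subnK <-; elim: (j - i)%N => // n IH /(fil_anti filF)/IH. Qed.

Lemma filX i x n : F i x -> F (n * i)%N (x ^+ n).
Proof.
move=> Fx; elim: n => [|n IH]; first exact: fil_top filF _.
by rewrite exprS mulSn; apply: (filM filF).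
Qed.

Lemma fil_adX s x : (forall i v, F i v -> F (i + s)%N (rcomm x v)) ->
  forall i v, F i v -> F (i + p * s)%N (rcomm (x ^+ p) v).
Proof.
move=> adx i v Fv; rewrite rcomm_exp_pchar //.
have : forall m, F (i + m * s)%N (iter m (rcomm x) v); last exact.
by elim=> [|m IH]; rewrite ?mul0n ?addn0 // mulSnr addnA iterS; apply: adx.
Qed.

(** Commutation with [x ^+ p] is the [p]-fold iterate of commutation with [x], so the gain in
    degree, 1 at the start, is multiplied by [p] at each stage. *)
Lemma fil_ad_pexp j x i v : F i v -> F (i + p ^ j)%N (rcomm (x ^+ (p ^ j)) v).
Proof.
elim: j i v => [|j IH] i v Fv.
  by rewrite expr1 addn1; apply: (fil_comm filF (fil_top filF x) Fv).
by rewrite expnS mulnC exprM mulnC; apply: fil_adX.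
Qed.

Lemma fil_jacobson a b s s' :
  (forall i v, F i v -> F (i + s)%N (rcomm a v)) ->
  (forall i v, F i v -> F (i + s)%N (rcomm b v)) -> F s' (rcomm a b) ->
  F (s' + (p - 2) * s)%N ((a + b) ^+ p - a ^+ p - b ^+ p).
Proof.
move=> ada adb Fab; apply: (jacobson_filtered (F := F)) => // [i | i].
  exact: is_ideal0 (fil_ideal filF i).
exact: is_idealB (fil_ideal filF i).
Qed.

Lemma fil_ad_sum (I : Type) s (r : seq I) (f : I -> R) :
  (forall x i v, F i v -> F (i + s)%N (rcomm (f x) v)) ->
  forall i v, F i v -> F (i + s)%N (rcomm (\sum_(x <- r) f x) v).
Proof.
move=> adr i v Fv; rewrite /rcomm mulr_suml mulr_sumr -sumrB.
by apply: (is_ideal_sum (fil_ideal filF (i + s))) => x _; apply: adr.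
Qed.

(** Every summand raises degrees by [N], so the Jacobson error has degree N + (p - 2)N. *)
Lemma fil_sum_pexp (I : Type) (r : seq I) (f : I -> R) N : (0 < N)%N ->
  (forall x i v, F i v -> F (i + N)%N (rcomm (f x) v)) ->
  F (p.-1 * N)%N ((\sum_(x <- r) f x) ^+ p - \sum_(x <- r) f x ^+ p).
Proof.
move=> N0 adf; have p2 := prime_gt1 pr_p; elim: r => [|x r IH].
  by rewrite !big_nil expr0n -(prednK (prime_gt0 pr_p)) subr0; exact: is_ideal0 (fil_ideal filF _).
rewrite !big_cons.
have := fil_jacobson (adf x) (fil_ad_sum r adf) (adf x _ _ (fil_top filF _)).
rewrite add0n -mulSn (_ : (p - 2).+1 = p.-1); last by lia.
move=> /(is_idealD (fil_ideal filF _) IH).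
set S := \sum_(j <- r) f j; set S' := \sum_(j <- r) f j ^+ p.
by rewrite addrC addrA subrK opprD addrA.
Qed.

(* The error term of the previous step enters with its p-th power, hence the
   loss of N / p in the exponent. *)
Lemma fil_sum_pexpn (I : Type) (r : seq I) (f : I -> R) j :
  F (p ^ j - p ^ j %/ p)%N ((\sum_(x <- r) f x) ^+ (p ^ j) - \sum_(x <- r) f x ^+ (p ^ j)).
Proof.
have p2 := prime_gt1 pr_p; elim: j => [|j].
  by rewrite !expr1 expn0 (eq_bigr f) ?subrr //; exact: is_ideal0 (fil_ideal filF _).
set N := (p ^ j)%N; set E := (N - N %/ p)%N; set X := \sum_(x <- r) f x ^+ N.
set e := _ - X => Fe.
have N0 : (0 < N)%N by rewrite expn_gt0 prime_gt0.
have leE : (E <= N)%N by rewrite leq_subr.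
(* Two errors must reach degree (p - 1)N. The Jacobson error of [X] and [e] has degree at least N +
   (p - 1)E, since [rcomm X e] has degree E + N and each further commutator gains [E]. The power
   [e ^+ p] has degree pE. *)
have Epk : (p.-1 * N <= N + p.-1 * E)%N.
  have := divn_eq N p; have := ltn_pmod N (prime_gt0 pr_p); rewrite /E; nia.
have pEpk : (p.-1 * N <= p * E)%N.
  have := divn_eq N p; have := ltn_pmod N (prime_gt0 pr_p); rewrite /E; nia.
rewrite expnSr mulnK ?prime_gt0 // -/N (_ : (N * p - N = p.-1 * N)%N); last by nia.
rewrite exprM -[_ ^+ N](subrK X) -/e [e + X]addrC.
have adX : forall i v, F i v -> F (i + N)%N (rcomm X v).
  by apply: fil_ad_sum => x i v Fv; apply: fil_ad_pexp.
have ade i v : F i v -> F (i + E)%N (rcomm e v).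
  by move=> Fv; apply: (fil_anti filF); rewrite addnC; apply: (fil_comm filF).
have adX' i v : F i v -> F (i + E)%N (rcomm X v).
  by move=> Fv; apply: fil_le (adX _ _ Fv); rewrite leq_add2l.
have J1 := fil_jacobson adX' ade (adX _ _ Fe).
have {}J1 : F (p.-1 * N)%N ((X + e) ^+ p - X ^+ p - e ^+ p).
  apply: fil_le J1; apply: leq_trans Epk _; rewrite [(E + N)%N]addnC -addnA leq_add2l.
  by rewrite -mulSn leq_mul2r; apply/orP; right; lia.
have J2 : F (p.-1 * N)%N (e ^+ p) by apply: fil_le (filX p Fe).
have J3 := fil_sum_pexp r N0 (fun x => @fil_ad_pexp j (f x)).
have := is_idealD (fil_ideal filF _) (is_idealD (fil_ideal filF _) J1 J2) J3.
rewrite subrK addrA subrK -/N.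
by under eq_bigr do rewrite -exprM.
Qed.
End Filtered.
End Jacobson.

(** * Filtrations by powers of a normal element *)

Section NormalElement.
Local Open Scope ring_scope.
Variables (R : nzRingType).

Definition pfil (y : R) (m : nat) (a : R) : Prop := exists b, a = y ^+ m * b.

Definition normal_elt (y : R) : Prop :=
  (forall b, exists b', y * b = b' * y) /\ (forall b, exists b', b * y = y * b').

Variables (y : R) (ny : normal_elt y).

Lemma normal_eltXr m b : exists b', b * y ^+ m = y ^+ m * b'.
Proof.
elim: m b => [|m IH] b; first by exists b; rewrite mul1r mulr1.
have [b' hb] := ny.2 b; have [b'' hb'] := IH b'; exists b''.
by rewrite exprS mulrA hb -mulrA hb' mulrA.
Qed.

Lemma pfil_ideal m : is_ideal (pfil y m).
Proof.
split=> [|_ _ [b ->] [c ->]|r _ [b ->]|r _ [b ->]]; first by exists 0; rewrite mulr0.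
- by exists (b + c); rewrite mulrDr.
- by have [b' hb] := normal_eltXr m r; exists (b' * b); rewrite !mulrA hb.
by exists (b * r); rewrite mulrA.
Qed.

Lemma pfil_pow_gen m (I : R -> Prop) : is_ideal I -> I (y ^+ m) -> forall a, pfil y m a -> I a.
Proof. by move=> idI Iy _ [b ->]; apply: is_idealMr. Qed.

Lemma pfilM i j a b : pfil y i a -> pfil y j b -> pfil y (i + j) (a * b).
Proof.
move=> [a' ->] [b' ->]; have [c hc] := normal_eltXr j a'.
by exists (c * b'); rewrite exprD -!mulrA; congr (_ * _); rewrite !mulrA hc.
Qed.

Lemma pfil_le i j a : (i <= j)%N -> pfil y j a -> pfil y i a.
Proof.
by move/subnKC <- => -[b ->]; exists (y ^+ (j - i) * b); rewrite exprD mulrA.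
Qed.

(** By the product rule the commutator of [y ^+ i * b] and [y ^+ j * c] reduces to [rcomm b c] and
    to commutators of a power of [y] with one element. The latter gain a degree by induction from
    the case of [y]. *)
Lemma pfil_filtration : (forall b, pfil y 2 (rcomm y b)) ->
  (forall b c, pfil y 1 (rcomm b c)) -> filtration (pfil y).
Proof.
move=> ad_y comm1; have id m := pfil_ideal m.
have comm_yX i b : pfil y i.+1 (rcomm (y ^+ i) b).
  elim: i => [|i IH]; first by rewrite /rcomm mul1r mulr1 subrr; apply: is_ideal0.
  have -> : rcomm (y ^+ i.+1) b = y * rcomm (y ^+ i) b + rcomm y b * y ^+ i.
    by rewrite /rcomm exprS mulrBr mulrBl !mulrA addrA subrK.
  apply: (is_idealD (id _)).
    by rewrite -[i.+2]add1n; apply: pfilM IH; exists 1; rewrite expr1 mulr1.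
  rewrite -[i.+2]addn1 addSnnS addnC; apply: pfilM => //.
  by exists 1; rewrite mulr1.
split=> //.
- by move=> x; exists x; rewrite mul1r.
- by move=> i x; apply: pfil_le.
- exact: pfilM.
move=> i j _ _ [b ->] [c ->].
have rcommC u v : rcomm u v = - rcomm v u by rewrite /rcomm opprB.
have -> : rcomm (y ^+ i * b) (y ^+ j * c) =
   y ^+ i * y ^+ j * rcomm b c + y ^+ i * rcomm b (y ^+ j) * c
     - y ^+ j * rcomm c (y ^+ i) * b.
  have e (s t X Y : R) : X - Y = (s - t) + (X - s) - (Y - t).
    by rewrite opprB [s - t + _]addrC !addrA !subrK.
  rewrite /rcomm !(mulrBr, mulrBl) !mulrA.
  have -> : y ^+ j * y ^+ i = y ^+ i * y ^+ j by rewrite -!exprD addnC.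
  exact: e.
apply: (is_idealB (id _)); first apply: (is_idealD (id _)).
- rewrite -addn1; apply: pfilM => //; exists 1; by rewrite exprD mulr1.
- apply: (is_idealMr (id _)); rewrite -addnS; apply: pfilM; first by exists 1; rewrite mulr1.
  by rewrite rcommC; apply: is_idealN.
apply: (is_idealMr (id _)); rewrite addnC -addnS; apply: pfilM; first by exists 1; rewrite mulr1.
by rewrite rcommC; apply: is_idealN.
Qed.

(** A Nakayama argument: substituting the congruence into itself raises the exponent of [y] until
    nilpotency kills the term. *)
Lemma normal_elt_nilp_mod (K : R -> Prop) m n b : is_ideal K -> y ^+ n = 0 ->
  K (y ^+ m - y ^+ m.+1 * b) -> K (y ^+ m).
Proof.
move=> idK yn Kb.
have key i : exists c, K (y ^+ m - y ^+ (i + m) * c).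
  elim: i => [|i [c IH]]; first by exists 1; rewrite mulr1 subrr; apply: is_ideal0.
  exists (b * c); have := is_idealMr idK c (is_idealMl idK (y ^+ i) Kb).
  move=> /(is_idealD idK IH); rewrite mulrBr mulrBl !mulrA -!exprD addrA subrK addnS.
  by [].
by have [c] := key n; rewrite exprD yn !mul0r subr0.
Qed.

Lemma eq_pfil w : normal_elt w -> (forall a, pfil y 1 a <-> pfil w 1 a) ->
  forall m a, pfil y m a <-> pfil w m a.
Proof.
suff key (u v : R) : normal_elt v -> (forall a, pfil u 1 a -> pfil v 1 a) ->
    forall m a, pfil u m a -> pfil v m a.
  by move=> nw yw m a; split; apply: key => // b /yw.
move=> [_ vr] uv m _ [b ->]; elim: m b => [|m IH] b; first by exists b.
rewrite exprS -mulrA; have [c ->] := IH b.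
have [d ->] : pfil v 1 u by apply: uv; exists 1; rewrite mulr1.
rewrite expr1 mulrA -[v * d * _]mulrA.
have nvX k e : exists e', e * v ^+ k = v ^+ k * e'.
  elim: k e => [|k IHk] e; first by exists e; rewrite mul1r mulr1.
  have [e' he] := vr e; have [e'' he'] := IHk e'; exists e''.
  by rewrite exprS mulrA he -mulrA he' mulrA.
by have [e ->] := nvX m d; exists (e * c); rewrite exprS !mulrA.
Qed.
End NormalElement.

(** * Group algebras of p-groups with cyclic derived subgroup *)

Section CharPPowers.
Local Open Scope ring_scope.

Lemma subr1_pexp (R : nzRingType) p (x : R) j : p \in [pchar R] ->
  (x - 1) ^+ (p ^ j) = x ^+ (p ^ j) - 1.
Proof.
move=> pcR; elim: j => [|j IH]; first by rewrite !expr1.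
rewrite expnSr !exprM IH -!(pFrobenius_autE pcR).
by rewrite pFrobenius_autB_comm ?pFrobenius_aut1 //; apply: commr1.
Qed.

Lemma exprD_pexp (R : comNzRingType) p (x y : R) j : p \in [pchar R] ->
  (x + y) ^+ (p ^ j) = x ^+ (p ^ j) + y ^+ (p ^ j).
Proof.
by move=> pcR; apply: exprDn_pchar; rewrite pnatX (eq_pnat _ (pcharf_eq pcR)) pnat_id ?orbT ?(pcharf_prime pcR).
Qed.

Lemma sum_pexp (R : comNzRingType) p (I : Type) (r : seq I) (P : pred I) (f : I -> R) j :
  p \in [pchar R] ->
  (\sum_(i <- r | P i) f i) ^+ (p ^ j) = \sum_(i <- r | P i) f i ^+ (p ^ j).
Proof.
move=> pcR; apply: (big_morph (fun x : R => x ^+ (p ^ j))) => [x y|].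
  exact: exprD_pexp.
by rewrite expr0n -[_ == _]negbK -lt0n expn_gt0 prime_gt0 // (pcharf_prime pcR).
Qed.
End CharPPowers.

Section CyclicDerivedAlgebra.
Local Open Scope group_scope.
Local Open Scope ring_scope.
Variables (k : fieldType) (p : nat) (T : finGroupType) (z : T).
Hypotheses (pcK : p \in [pchar k]) (odd_p : odd p) (pT : p.-group [set: T]).
Hypothesis (Dz : [set: T]^`(1)%g = <[z]>).

Local Notation A := (galg k T).
Local Notation gd := (@gd k T).
Local Notation D := [set: T]^`(1)%g.
Local Notation C := 'C_[set: T](D)%g.
Local Notation ZD := ('Z([set: T]) <*> D)%g.

Let pr_p : prime p := pcharf_prime pcK.
Let nDT : (D <| [set: T])%g := der_normal 1 _.
Let cycD : cyclic D. Proof. by rewrite Dz cycle_cyclic. Qed.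
Let pcA : p \in [pchar A].
Proof. by rewrite pchar_lalg. Qed.
Let inT x : x \in [set: T]. Proof. by rewrite inE. Qed.
Let zD : z \in D. Proof. by rewrite Dz cycle_id. Qed.

Definition ygen : A := gd z - 1.
Local Notation y := ygen.

Lemma relI_der1_pfil a : relI D a <-> pfil y 1 a.
Proof.
have idD := relI_ideal k nDT; split; last first.
  by apply: pfil_pow_gen => //; rewrite expr1; apply/relI_gd1.
apply: relI_ind => [|b c [b' ->] [c' ->]|n b].
- by exists 0; rewrite mulr0.
- by exists (b' + c'); rewrite mulrDr.
move=> Dn; have /cycleP[i ->] : n \in <[z]> by rewrite -Dz.
exists ((\sum_(j < i) gd z ^+ j) * b).
by rewrite expr1 gdX subrX1 mulrA.
Qed.

Let zJ g : exists2 r, (r = 1 %[mod p])%N & (z ^ g = z ^+ r)%g.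
Proof.
have [r r1 hr] := der1_conjXg pr_p pT cycD (inT g); exists r => //.
exact: hr.
Qed.

Let galg_ind (P : A -> Prop) : P 0 -> (forall a b, P a -> P b -> P (a + b)) ->
  (forall c g, P (c *: gd g)) -> forall a, P a.
Proof. by move=> P0 PD Pg a; rewrite (galg_sum a); elim/big_ind: _. Qed.

Lemma ygen_normal : normal_elt y.
Proof.
split=> b; last first.
  have : relI D (b * y) by apply/relIMl/relI_gd1.
  by case/relI_der1_pfil => b' ->; exists b'; rewrite expr1.
elim/galg_ind: b => [|a b [a' ha] [b' hb]|c g]; first by exists 0; rewrite mulr0 mul0r.
  by exists (a' + b'); rewrite [LHS]mulrDr [RHS]mulrDl ha hb.
have [r _ zr] := zJ g.
exists (c *: (gd g * (\sum_(j < r) gd z ^+ j))).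
rewrite -scalerAr -scalerAl; congr (_ *: _).
have -> : y * gd g = gd g * (gd z ^+ r - 1).
  by rewrite mulrBl mul1r mulrBr mulr1 -gdX -zr -!gdM conjgC.
rewrite subrX1 -mulrA; congr (_ * _).
apply: commr_sum => i _; apply: commrX; apply: commr_sym; apply: commrB; last exact: commr1.
by [].
Qed.

(** For a group element g the commutator is g(z^r - z) with r = 1 mod p. Frobenius turns z^(r-1) - 1
    into the p-th power of z^((r-1)/p) - 1, which lies in J^p and so in J^2. *)
Lemma ygen_comm b : pfil y 2 (rcomm y b).
Proof.
have id2 := pfil_ideal ygen_normal 2.
elim/galg_ind: b => [|a b Ia Ib|c g].
- by rewrite /rcomm mulr0 mul0r subrr; apply: (is_ideal0 id2).
- have -> : rcomm y (a + b) = rcomm y a + rcomm y b.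
    by rewrite /rcomm [y * _]mulrDr [_ * y]mulrDl opprD addrACA.
  exact: (is_idealD id2).
have [r r1 zr] := zJ g.
have -> : rcomm y (c *: gd g) = c *: gd g * (gd z ^+ r - gd z).
  rewrite /rcomm -!scalerAr -!scalerAl -scalerBr; congr (_ *: _).
  rewrite {1}/ygen mulrBl mul1r [gd g * y]mulrBr mulr1 opprB addrA subrK mulrBr.
  by rewrite -gdX -zr -!gdM conjgC.
apply: (is_idealMl id2).
have -> : gd z ^+ r - gd z = gd z * (gd z ^+ (r %/ p) - 1) ^+ p.
  have := subr1_pexp (gd z ^+ (r %/ p)) 1 pcA; rewrite expn1 => ->.
  rewrite mulrBr mulr1 -exprM -exprS {1}(divn_eq r p) r1 modn_small ?prime_gt1 //.
  by rewrite addn1.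
apply: (is_idealMl id2).
apply: (@pfil_le _ y 2 (p * 1)); first by rewrite muln1 prime_gt1.
rewrite subrX1.
have : pfil y 1 (y * \sum_(i < r %/ p) gd z ^+ i).
  by eexists; rewrite expr1.
move: (_ * _) => v yv; elim: p => [|n IH]; first by exists (v ^+ 0); rewrite mul1r.
by rewrite exprS mulSn; apply: (pfilM ygen_normal).
Qed.

Lemma galg_filtration : filtration (pfil y).
Proof.
apply: pfil_filtration; [exact: ygen_normal | exact: ygen_comm |].
move=> b c; apply/relI_der1_pfil/relI_der1_comm/ideal_gen_mem.
by exists b, c.
Qed.

Lemma ygen_nilp : y ^+ #|D| = 0.
Proof.
have [n on] := p_natP (pgroupS (der_sub 1 [set: T]) pT : p.-group D).
rewrite on (subr1_pexp _ _ pcA) -gdX -on.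
by rewrite (_ : z ^+ _ = 1)%g ?gd1 ?subrr // expg_cardG.
Qed.

(** The main term of [x ^+ N]. For [N] a power of [p] it is additive and Frobenius-semilinear in
    [x], unlike the power itself. *)
Definition powsum (N : nat) (x : A) : A := \sum_g x g ^+ N *: gd (g ^+ N)%g.

Lemma powsum_mod x j :
  pfil y (p ^ j - p ^ j %/ p)%N (x ^+ (p ^ j) - powsum (p ^ j) x).
Proof.
have := fil_sum_pexpn pcA galg_filtration (index_enum T) (fun g => x g *: gd g) j.
rewrite -galg_sum; congr (pfil y _ (_ - _)).
by apply: eq_bigr => g _; rewrite exprZn gdX.
Qed.

Lemma powsum_mod_der1 x j : relI D (x ^+ (p ^ j) - powsum (p ^ j) x).
Proof.
apply/relI_der1_pfil; apply: pfil_le (powsum_mod x j).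
by rewrite subn_gt0 ltn_Pdiv ?prime_gt1 // expn_gt0 prime_gt0.
Qed.

Lemma powsumD j a b : powsum (p ^ j) (a + b) = powsum (p ^ j) a + powsum (p ^ j) b.
Proof.
rewrite -big_split; apply: eq_bigr => g _.
by rewrite gaddE (exprD_pexp _ _ _ pcK) scalerDl.
Qed.

Lemma powsum_gd j c g : powsum (p ^ j) (c *: gd g) = c ^+ (p ^ j) *: gd (g ^+ (p ^ j))%g.
Proof.
have pj : (0 < p ^ j)%N by rewrite expn_gt0 prime_gt0.
rewrite /powsum (bigD1 g) //= big1 => [|x /negPf xg].
  by rewrite gscaleE gdE eqxx mulr1 addr0.
by rewrite gscaleE gdE xg mulr0 expr0n -[_ == _]negbK -lt0n pj scale0r.
Qed.

(** Central elements are constant on conjugacy classes, and the noncentral classes of a p-group have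
    size divisible by [p]. *)
Lemma class_fun_sum0 (v : A) (S : {set T}) : (forall b, v * b = b * v) ->
  (forall x g, x \in S -> (x ^ g)%g \in S) -> (forall x, x \in S -> x \notin 'Z([set: T])%g) ->
  \sum_(x in S) v x = 0.
Proof.
move=> cv SJ SZ.
have vJ x g : v (x ^ g)%g = v x.
  have := congr1 (fun b : A => b (x * g)%g) (cv (gd g)).
  by rewrite gmul_gdE mul_gdE mulgK.
have actS : [acts [set: T], on S | 'J].
  apply/actsP=> g _ x; apply/idP/idP => Sx; last exact: SJ.
  by rewrite -(conjgK g x); apply: SJ.
rewrite (set_partition_big _ (orbit_partition actS)) /= big1 // => B.
case/imsetP=> x Sx ->{B}.
rewrite (eq_bigr (fun=> v x)) => [|_ /imsetP[g _ ->]]; last exact: vJ.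
rewrite sumr_const; set n := #|_|.
have /p_natP[[|m] nE] : p.-nat n.
- by rewrite /n card_orbit; apply: pnat_dvd pT; apply: dvdn_indexg.
- case/negP: (SZ x Sx); apply/centerP; split=> // g _; apply/commgP/conjg_fixP.
  have : (x ^ g)%g \in orbit 'J [set: T] x by apply: mem_orbit.
  by rewrite (card_orbit1 nE) => /set1P.
by rewrite nE expnSr mulrnA -mulr_natr (pcharf0 pcK) mulr0.
Qed.

Definition center_aug_or_comm (v : A) : Prop :=
  (exists b c : A, v = b * c - c * b) \/ ((forall b : A, v * b = b * v) /\ gaug v = 0).

(** For central [v], a coset of [ZD] other than [ZD] is stable under conjugation and misses the
    centre, so [v] sums to 0 on it. The complement of [ZD] also contributes 0, which leaves the
    augmentation as the sum over [ZD]. Conversely, [gd n - 1] is central of augmentation 0 for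
    central [n]. *)
Lemma relI_center_der1 (a : A) : ideal_gen center_aug_or_comm a <-> relI ZD a.
Proof.
have sDZ : D \subset ZD by rewrite joing_subr.
have nZ : (ZD <| [set: T])%g by apply: sub_der1_normal; rewrite ?subsetT.
split.
  apply: (ideal_gen_min (relI_ideal k nZ)) => v [[b [c ->]]|[cv av] h].
    apply: (relI_subset sDZ); apply/relI_der1_comm/ideal_gen_mem.
    by exists b, c.
  have nZJ x g : (x ^ g \in ZD)%g = (x \in ZD).
    by rewrite memJ_norm // (subsetP (normal_norm nZ)).
  have csumE : csum ZD v h = \sum_(x in ZD :* h) v x.
    rewrite /csum [RHS](reindex_inj (mulIg h)) /=; apply: eq_bigl => x.
    by rewrite mem_rcoset mulgK.
  have [Zh | Zh] := boolP (h \in ZD); last first.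
    rewrite csumE; apply: class_fun_sum0 => // x.
      move=> g; rewrite !mem_rcoset => Zx.
      have -> : (x ^ g * h^-1 = [~ g, x^-1] * (x * h^-1))%g by rewrite conjg_Rmul mulgA.
      by rewrite groupM // (subsetP sDZ) // mem_commg.
    rewrite mem_rcoset => Zx; apply: contra Zh => ZTx.
    have Zx' : x \in ZD by apply: mem_gen; rewrite inE ZTx.
    by rewrite -groupV -(groupMl _ Zx').
  rewrite csumE (rcoset_id Zh).
  have sumC : \sum_(x in ~: ZD) v x = 0.
    apply: class_fun_sum0 => // [x g|x]; first by rewrite !inE nZJ.
    by rewrite inE; apply: contra => ZTx; apply: mem_gen; rewrite inE ZTx.
  have : gaug v = \sum_(x in ZD) v x + \sum_(x in ~: ZD) v x.
    rewrite /gaug (bigID (mem ZD)) /=; congr (_ + _); apply: eq_bigl => x //.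
    by rewrite inE.
  by rewrite av sumC addr0 => <-.
apply: relI_gen_ind; [exact: ideal_gen0 | exact: ideal_genD |].
move=> n b; rewrite inE => /orP[/centerP[_ cn] | Dn]; apply: ideal_genMr.
  apply: ideal_gen_mem; right; split; last by rewrite gaugB !gaug_gd subrr.
  elim/galg_ind => [|a' b' IHa IHb|c g]; first by rewrite mulr0 mul0r.
    by rewrite [LHS]mulrDr [RHS]mulrDl IHa IHb.
  rewrite -scalerAl -scalerAr; congr (_ *: _).
  by rewrite mulrBl mulrBr mul1r mulr1 -!gdM cn.
have : relI D (gd n - 1 : A) by apply/relI_gd1.
move/relI_der1_comm; apply: (ideal_gen_min (ideal_gen_ideal _)) => v cv.
by apply: ideal_gen_mem; left.
Qed.

Lemma csum_sum (N : {group T}) (I : Type) (r : seq I) (F : I -> A) x :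
  csum N (\sum_(i <- r) F i) x = \sum_(i <- r) csum N (F i) x.
Proof.
apply: (big_morph (fun a : A => csum N a x)) => [a b|]; first exact: csumD.
by rewrite /csum big1 // => g _; rewrite ffunE.
Qed.

Lemma csum_powsum (M : {group T}) N x h :
  csum M (powsum N x) h = \sum_(g | h \in M :* (g ^+ N)%g) x g ^+ N.
Proof.
rewrite csum_sum [RHS]big_mkcond; apply: eq_bigr => g _.
by rewrite csumZ csum_gd; case: ifP => _; rewrite ?mulr1 ?mulr0.
Qed.

Lemma mem_rcoset_root (M : {group T}) n g h : D \subset M ->
  (g ^+ n \in M :* (h ^+ n))%g = (g \in root_set M [set: T] n :* h)%g.
Proof.
move=> sDM; have nM := sub_der1_normal sDM (subsetT M).
have N x : x \in 'N(M)%g by rewrite (subsetP (normal_norm nM)).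
have cTM := sub_der1_abelian sDM.
have eqn u : (u ^+ n \in M)%g = (coset M u ^+ n == 1)%g.
  by rewrite -morphX //=; apply/idP/eqP=> [/coset_id // | ]; apply: coset_idr.
rewrite !mem_rcoset !inE /= eqn.
have -> : (g ^+ n * (h ^+ n)^-1 \in M)%g = (coset M (g ^+ n * (h ^+ n)^-1) == 1)%g.
  by apply/idP/eqP=> [/coset_id // | ]; apply: coset_idr.
rewrite !morphM ?groupV //= !morphV //= !morphX //= expgMn ?expgVn //.
by apply: (centsP cTM); rewrite ?groupV mem_quotient.
Qed.

(** Modulo [M] the power map is a homomorphism of abelian groups. So the sum of [powsum (p ^ s) x]
    over the coset of [h ^+ (p ^ s)] is the [p ^ s]-th power of the sum of [x] over the coset of [h]
    for the root set, and a field has no nilpotents. Cosets of [M] without such a power carry the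
    empty sum. *)
Lemma relI_root_set (M : {group T}) (x : A) s : D \subset M ->
  relI M (x ^+ (p ^ s)) <-> relI (root_set M [set: T] (p ^ s)) x.
Proof.
move=> sDM.
have idM := relI_ideal k (sub_der1_normal sDM (subsetT M)).
have IDM := relI_subset sDM (powsum_mod_der1 x s).
have -> : relI M (x ^+ (p ^ s)) <-> relI M (powsum (p ^ s) x).
  split=> Ix; last by rewrite -(subrK (powsum (p ^ s) x) (x ^+ _)); apply: (is_idealD idM).
  by rewrite -[powsum _ _](subKr (x ^+ (p ^ s))); apply: (is_idealB idM).
have csumE h : csum M (powsum (p ^ s) x) (h ^+ (p ^ s))%g =
               csum (root_set M [set: T] (p ^ s)) x h ^+ (p ^ s).
  rewrite csum_powsum (sum_pexp _ _ _ _ pcK) /=.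
  rewrite [RHS](reindex_inj (mulIg h^-1)%g) /=; apply: eq_big => g.
    by rewrite rcoset_sym mem_rcoset_root // mem_rcoset.
  by rewrite mulgKV.
have p0 : (0 < p ^ s)%N by rewrite expn_gt0 prime_gt0.
split=> Ix h.
  have /eqP := Ix (h ^+ (p ^ s))%g; rewrite csumE expf_eq0 p0 => /eqP.
  by [].
have [/existsP[g /rcoset_eqP Mg] | nex] := boolP [exists g, h \in M :* (g ^+ (p ^ s))%g].
  have -> : csum M (powsum (p ^ s) x) h = csum M (powsum (p ^ s) x) (g ^+ (p ^ s))%g.
    by rewrite !csum_powsum; apply: eq_bigl => g'; rewrite [LHS]rcoset_sym Mg rcoset_sym.
  by rewrite csumE Ix expr0n -[_ == _]negbK -lt0n p0.
rewrite csum_powsum big_pred0 // => g; apply: contraNF nex => hg.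
by apply/existsP; exists g.
Qed.

Local Notation U j := (mhoP p j C).

Let nUT j : (U j <| [set: T])%g.
Proof. by rewrite /normal subsetT mho_cent_der1_norm. Qed.

Lemma powsum0 j : powsum (p ^ j) 0 = 0.
Proof.
have := powsum_gd j 0 1%g; rewrite scale0r => ->.
by rewrite expr0n -[_ == _]negbK -lt0n expn_gt0 prime_gt0 // scale0r.
Qed.

Lemma powsumB j a b : powsum (p ^ j) (a - b) = powsum (p ^ j) a - powsum (p ^ j) b.
Proof.
by apply: (addIr (powsum (p ^ j) b)); rewrite -powsumD !subrK.
Qed.

(** By additivity it suffices to treat (n - 1)g with [n] in [C]. As ng = g(n^g), the power (ng)^N
    equals g^N u with [u] in [U j], which leaves g^N(u - 1). *)
Lemma relI_mho_powsum (x : A) j : relI C x -> relI (U j) (powsum (p ^ j) x).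
Proof.
have idU := relI_ideal k (nUT j).
move: x; apply: relI_ind => [|a b Ia Ib|n b Cn]; first by rewrite powsum0; apply: is_ideal0 idU.
  by rewrite powsumD; apply: (is_idealD idU).
elim/galg_ind: b => [|a b Ia Ib|c g].
- by rewrite mulr0 powsum0; apply: is_ideal0 idU.
- by rewrite mulrDr powsumD; apply: (is_idealD idU).
rewrite mulrBl mul1r -scalerAr -gdM powsumB !powsum_gd -scalerBr; apply: relIZ.
have Cng : (n ^ g)%g \in C.
  by rewrite memJ_norm // (subsetP (normal_norm (cent_der1_normal [group of [set: T]]))) // inE.
have [u Uu] := expMg_cent_der1 pr_p odd_p pT cycD j (inT g) Cng.
rewrite -conjgC => ->; rewrite gdM -[X in _ - X]mulr1 -mulrBr.
by apply: (is_idealMl idU); apply/relI_gd1.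
Qed.

Lemma relI_mho_pexp (x : A) j : relI C x ->
  exists2 b, relI (U j) (x ^+ (p ^ j) - b) & pfil y (p ^ j - p ^ j %/ p)%N b.
Proof.
move=> Cx; exists (x ^+ (p ^ j) - powsum (p ^ j) x); last exact: powsum_mod.
by rewrite subKr; apply: relI_mho_powsum.
Qed.

Definition pexp_or (I J : A -> Prop) (N : nat) (v : A) : Prop :=
  (exists2 x, I x & v = x ^+ N) \/ J v.

(** Modulo [relI D] a power is its [powsum], which lies in [relI (U j)]; conversely c^N - 1 = (c -
    1)^N. *)
Lemma relI_mho_der1 j (a : A) :
  ideal_gen (pexp_or (relI C) (relI D) (p ^ j)) a <-> relI (U j <*> D) a.
Proof.
have nUD : (U j <*> D <| [set: T])%g by apply: sub_der1_normal; rewrite ?subsetT ?joing_subr.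
have idUD := relI_ideal k nUD; split.
  apply: (ideal_gen_min idUD) => v [[x Cx ->]|]; last by apply: relI_subset; apply: joing_subr.
  rewrite -(subrK (powsum (p ^ j) x) (x ^+ _)); apply: (is_idealD idUD).
    exact: relI_subset (joing_subr _ _) (powsum_mod_der1 x j).
  exact: relI_subset (joing_subl _ _) (relI_mho_powsum j Cx).
apply: relI_gen_ind; [exact: ideal_gen0 | exact: ideal_genD |].
move=> n b; rewrite inE => /orP[Un | Dn]; apply/ideal_genMr/ideal_gen_mem; last first.
  by right; apply/relI_gd1.
have [c Cc ->] := mhoP_cent_der1 odd_p cycD _ _ Un.
left; exists (gd c - 1); first exact/relI_gd1.
by rewrite (subr1_pexp _ _ pcA) gdX.
Qed.

(* As N - N/p > p^a, the ideal I(U_j)A + J^(N - N/p) meets the powers of J from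
   J^(p^a) on only in I(U_j)A. *)
Lemma mho_der1_pexp j a : (a < j)%N ->
  ideal_gen (pexp_or (relI C) (pfil y (p ^ j - p ^ j %/ p)) (p ^ j)) (y ^+ (p ^ a)) <->
  (z ^+ (p ^ a))%g \in U j.
Proof.
move=> lt_aj; have idU := relI_ideal k (nUT j); set M := (_ - _)%N; set N := (p ^ j)%N.
have yE : y ^+ (p ^ a) = gd (z ^+ (p ^ a)) - 1 by rewrite (subr1_pexp _ _ pcA) gdX.
split=> [|Uz]; last first.
  have [c Cc zE] := mhoP_cent_der1 odd_p cycD _ _ Uz.
  apply: ideal_gen_mem; left; exists (gd c - 1); first exact/relI_gd1.
  by rewrite yE zE (subr1_pexp _ _ pcA) gdX.
pose I v := exists2 b, relI (U j) (v - b) & pfil y M b.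
have idM := pfil_ideal ygen_normal M.
have idI : is_ideal I.
  split=> [|v w [b Ub Mb] [c Uc Mc]|r v [b Ub Mb]|r v [b Ub Mb]].
  - by exists 0; [rewrite subrr; apply: (is_ideal0 idU) | apply: (is_ideal0 idM)].
  - exists (b + c); last exact: (is_idealD idM).
    by rewrite opprD addrACA; apply: (is_idealD idU).
  - exists (r * b); last exact: (is_idealMl idM).
    by rewrite -mulrBr; apply: (is_idealMl idU).
  exists (b * r); last exact: (is_idealMr idM).
  by rewrite -mulrBl; apply: (is_idealMr idU).
move/(ideal_gen_min idI) => Iy; have [|b Ub Mb] := Iy.
  move=> v [[x Cx ->]|Mv]; first exact: relI_mho_pexp.
  by exists v => //; rewrite subrr; apply: (is_ideal0 idU).
apply/(relI_gd1 k); rewrite -yE.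
(* [M] is (p - 1)p^(j-1) with p - 1 at least 2 and [a] at most j - 1; for [p = 2] the inequality
   would fail at a = j - 1. *)
have lt_aM : (p ^ a < M)%N.
  have -> : M = (p.-1 * p ^ j.-1)%N.
    rewrite /M -[in LHS](ltn_predK lt_aj) expnS mulKn ?prime_gt0 //.
    by rewrite -{1}(prednK (prime_gt0 pr_p)) mulSn addKn.
  have p3 : (2 < p)%N by rewrite odd_prime_gt2.
  have le_a : (p ^ a <= p ^ j.-1)%N by rewrite leq_pexp2l ?prime_gt0 // -ltnS (ltn_predK lt_aj).
  have : (0 < p ^ a)%N by rewrite expn_gt0 prime_gt0.
  nia.
(* The strict inequality supplies the extra factor [y]: [b] is [y ^+ (p ^ a).+1 * c]. *)
have [c bE] := pfil_le lt_aM Mb.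
by apply: (normal_elt_nilp_mod idU ygen_nilp (b := c)); rewrite -bE.
Qed.

(** With [p ^ n] the order of the group, [powsum (p ^ n) a] is the [p ^ n]-th power of the
    augmentation, hence 0. So [a ^+ (p ^ n)] lies in the nilpotent ideal J. *)
Lemma gaug0_nilp (a : A) : gaug a = 0 -> exists m, a ^+ m = 0.
Proof.
move=> a0; have [n oT] := p_natP pT.
have p0 : (0 < p ^ n)%N by rewrite expn_gt0 prime_gt0.
have : relI D (a ^+ (p ^ n)).
  rewrite -[a ^+ _]subr0; have <- : powsum (p ^ n) a = 0; last exact: powsum_mod_der1.
  rewrite /powsum (eq_bigr (fun g => a g ^+ (p ^ n) *: gd 1%g)) => [|g _].
    rewrite -scaler_suml -(sum_pexp _ _ _ _ pcK) -/(gaug a) a0.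
    by rewrite expr0n -[_ == _]negbK -lt0n p0 scale0r.
  by rewrite -oT expg_cardG.
move/relI_der1_pfil => Ja; exists (p ^ n * #|D|)%N.
have [b hb] := filX galg_filtration #|D| Ja.
by rewrite exprM hb muln1 ygen_nilp mul0r.
Qed.
End CyclicDerivedAlgebra.

(** * Transport along an isomorphism of group algebras *)

Section Transport.
Local Open Scope group_scope.
Local Open Scope ring_scope.
Variable (k : fieldType).
Implicit Types (T : finGroupType).

Definition galg_isom T1 T2 (f : galg k T1 -> galg k T2) (f' : galg k T2 -> galg k T1) :=
  [/\ {morph f : a b / a + b}, {morph f : a b / a * b}, f 1 = 1,
      forall c a, f (c *: a) = c *: f a & cancel f f' /\ cancel f' f].

Lemma galg_isom_sym T1 T2 (f : galg k T1 -> galg k T2) f' :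
  galg_isom f f' -> galg_isom f' f.
Proof.
case=> fD fM f1 fZ [fK f'K]; have f_inj := can_inj fK; split=> //.
- by move=> a b; apply: f_inj; rewrite fD !f'K.
- by move=> a b; apply: f_inj; rewrite fM !f'K.
- by rewrite -f1 fK.
by move=> c a; apply: f_inj; rewrite fZ !f'K.
Qed.

Section Isom.
Variables (T1 T2 : finGroupType) (f : galg k T1 -> galg k T2) (f' : galg k T2 -> galg k T1).
Hypothesis isof : galg_isom f f'.

Let fD : {morph f : a b / a + b}. Proof. by case: isof. Qed.
Let fM : {morph f : a b / a * b}. Proof. by case: isof. Qed.
Let f1 : f 1 = 1. Proof. by case: isof. Qed.
Let fZ c a : f (c *: a) = c *: f a. Proof. by case: isof. Qed.
Let fK : cancel f f'. Proof. by case: isof => _ _ _ _ []. Qed.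
Let f'K : cancel f' f. Proof. by case: isof => _ _ _ _ []. Qed.
Let f0 : f 0 = 0. Proof. by rewrite -(scale0r 0) fZ !scale0r. Qed.

Let fX a n : f (a ^+ n) = f a ^+ n.
Proof. by elim: n => [|n IH]; rewrite ?f1 // !exprS fM IH. Qed.
Let fsum (I : Type) (r : seq I) (F : I -> galg k T1) :
  f (\sum_(i <- r) F i) = \sum_(i <- r) f (F i).
Proof. exact: (big_morph f fD f0). Qed.

(** The augmentation of the image of a group element is a root of unity of [p]-power order in
    characteristic [p], hence 1. *)
Lemma galg_isom_gaug p a : p \in [pchar k] -> p.-group [set: T1] -> gaug (f a) = gaug a.
Proof.
move=> pcK /p_natP[n oT].
have fgd g : gaug (f (gd k g)) = 1.
  have xp : gaug (f (gd k g)) ^+ (p ^ n) = 1.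
    rewrite -gaugX -fX -gdX -oT (_ : g ^+ _ = 1)%g ?f1 ?gaug_gd //.
    by apply: expg_cardG; rewrite inE.
  have : (gaug (f (gd k g)) - 1) ^+ (p ^ n) = 0 by rewrite (subr1_pexp _ _ pcK) xp subrr.
  by move/eqP; rewrite expf_eq0 subr_eq0 => /andP[_ /eqP].
have gsum T (F : T1 -> galg k T) : gaug (\sum_g F g) = \sum_g gaug (F g).
  apply: (big_morph (fun b : galg k T => gaug b)) => [b c|]; first exact: gaugD.
  by rewrite -(scale0r 0) gaugZ mul0r.
rewrite {1}(galg_sum a) fsum gsum; apply: eq_bigr => g _.
by rewrite fZ gaugZ fgd mulr1.
Qed.

(** A dimension count: the indices are the dimensions of the quotients by the relative augmentation
    ideals. With more cosets of [N] than of [M], some nonzero combination of representatives modulo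
    [N] would be sent into [relI M], hence would lie in [relI N], which is impossible. *)
Lemma galg_isom_index (N : {group T1}) (M : {group T2}) :
  (forall a, relI M (f a) -> relI N a) -> (#|[set: T1] : N| <= #|[set: T2] : M|)%N.
Proof.
move=> fNM; pose RN := rcosets N [set: T1]; pose RM := rcosets M [set: T2].
rewrite -[#|_ : N|]/#|RN| -[#|_ : M|]/#|RM| leqNgt; apply/negP=> lt_MN.
pose r1 (i : 'I_#|RN|) := repr (enum_val i : {set T1}).
pose r2 (j : 'I_#|RM|) := repr (enum_val j : {set T2}).
pose X := \matrix_(i < #|RN|, j < #|RM|) csum M (f (gd k (r1 i))) (r2 j).
have /rowV0Pn[v /sub_kermxP vX nzv] : kermx X != 0.
  rewrite kermx_eq0 /row_free neq_ltn; apply/orP; left.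
  exact: leq_ltn_trans (rank_leq_col X) lt_MN.
pose a := \sum_i v 0 i *: gd k (r1 i).
have Ma : relI M (f a).
  move=> x; have Rx : M :* x \in RM by apply/imsetP; exists x; rewrite ?rcosetE ?inE.
  pose j := enum_rank_in Rx (M :* x).
  have jE : enum_val j = M :* x by apply: enum_rankK_in.
  have : r2 j \in M :* x by rewrite /r2 jE; apply: mem_repr_rcoset.
  case/rcosetP=> u Mu r2E; rewrite -(csum_mulN _ _ Mu) -r2E.
  rewrite /a fsum csum_sum; have := congr1 (fun w : 'rV_#|RM| => w 0 j) vX.
  rewrite !mxE => vX0; rewrite -[RHS]vX0; apply: eq_bigr => i _.
  by rewrite fZ csumZ [X in _ = _ * X]mxE.
have Na := fNM _ Ma; case/eqP: nzv; apply/rowP=> i; rewrite mxE.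
have memr i' : r1 i' \in (enum_val i' : {set T1}) /\ N :* r1 i' = enum_val i'.
  have /imsetP[x _ xE] : (enum_val i' : {set T1}) \in RN by apply: enum_valP.
  have Nx : r1 i' \in N :* x by rewrite /r1 xE rcosetE; apply: mem_repr_rcoset.
  by rewrite xE rcosetE (rcoset_eqP Nx); split=> //; rewrite -(rcoset_eqP Nx).
rewrite -[RHS](Na (r1 i)) /a csum_sum (bigD1 i) //= big1 ?addr0.
  by rewrite csumZ csum_gd rcoset_refl mulr1.
move=> i' ne_i'; rewrite csumZ csum_gd.
have [|_] := boolP (r1 i \in N :* r1 i'); last by rewrite mulr0.
have [[_ e] [_ e']] := (memr i, memr i').
move=> /rcoset_eqP; rewrite e e' => /enum_val_inj eqi.
by rewrite eqi eqxx in ne_i'.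
Qed.
End Isom.

Lemma geometric_unit (R : nzRingType) (x : R) m : x ^+ m = 0 ->
  (1 - x) * (\sum_(i < m) x ^+ i) = 1.
Proof. by move=> xm; rewrite -opprB mulNr -subrX1 xm sub0r opprK. Qed.

(** The predicates carry no decision procedure, so the dichotomy is built by induction along the
    enumeration. *)
Lemma exists_or_forall (I : finType) (P Q : I -> Prop) :
  (forall i, P i \/ Q i) -> (exists i, P i) \/ (forall i, Q i).
Proof.
move=> PQ; suff: (exists i, P i) \/ (forall i, i \in enum I -> Q i).
  by case=> [|H]; [left | right=> i; apply: H; rewrite mem_enum].
elim: (enum I) => [|i s [[j Pj]|IH]]; first by right.
  by left; exists j.
have [Pi | Qi] := PQ i; first by left; exists i.
by right=> j; rewrite inE => /orP[/eqP-> // | /IH].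
Qed.

Section IsomCyclic.
Variables (T1 T2 : finGroupType) (f : galg k T1 -> galg k T2) (f' : galg k T2 -> galg k T1).
Hypothesis isof : galg_isom f f'.
Let fK : cancel f f'. Proof. by case: isof => _ _ _ _ []. Qed.
Let f'K : cancel f' f. Proof. by case: isof => _ _ _ _ []. Qed.
Let f0 : f 0 = 0.
Proof. by case: isof => _ _ _ fZ _; rewrite -(scale0r 0) fZ !scale0r. Qed.
Let f'0 : f' 0 = 0. Proof. by rewrite -f0 fK. Qed.

Lemma galg_isom_eq_index (N : {group T1}) (M : {group T2}) :
  (forall a, relI N a <-> relI M (f a)) -> #|[set: T1] : N| = #|[set: T2] : M|.
Proof.
move=> NM; apply/eqP; rewrite eqn_leq (galg_isom_index isof) => [|a /NM //].
by rewrite (galg_isom_index (galg_isom_sym isof)) // => a /NM; rewrite f'K.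
Qed.

Lemma relI1 T (a : galg k T) : relI 1%g a <-> a = 0.
Proof.
have csum1 (b : galg k T) x : csum 1%g b x = b x by rewrite /csum big_set1 mul1g.
by split=> [Ia | -> x]; [apply/ffunP=> x; rewrite -csum1 Ia ffunE | rewrite csum1 ffunE].
Qed.

Lemma galg_isom_card : #|[set: T1]| = #|[set: T2]|.
Proof.
rewrite -!indexg1; apply: (@galg_isom_eq_index 1%G 1%G) => a.
split=> /relI1 => [->|fa0]; apply/relI1 => //.
by rewrite -(fK a) fa0.
Qed.

Lemma galg_isom_ideal_gen (P : galg k T1 -> Prop) (Q : galg k T2 -> Prop) :
  (forall a, P a <-> Q (f a)) -> forall a, ideal_gen P a <-> ideal_gen Q (f a).
Proof.
move=> PQ a; have [fD fM _ _ _] := isof; have [f'D f'M _ _ _] := galg_isom_sym isof.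
split; first by apply: ideal_gen_morph => // x /PQ; apply: ideal_gen_mem.
rewrite -{2}(fK a); apply: ideal_gen_morph => // x.
by rewrite -{1}(f'K x) => /PQ; apply: ideal_gen_mem.
Qed.

Lemma galg_isom_der1 a : relI [set: T1]^`(1)%g a <-> relI [set: T2]^`(1)%g (f a).
Proof.
have [fD fM f1 fZ _] := isof.
have fB b c : f (b - c) = f b - f c by rewrite -scaleN1r fD fZ scaleN1r.
apply: iff_trans (iff_sym (relI_der1_comm a)) _.
apply: iff_trans _ (relI_der1_comm (f a)); apply: galg_isom_ideal_gen => {}a.
split=> -[b [c h]]; first by exists (f b), (f c); rewrite h fB !fM.
by exists (f' b), (f' c); apply: (can_inj fK); rewrite fB !fM !f'K.
Qed.

Section Cyclic.
Variables (p : nat) (z1 : T1).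
Hypotheses (pcK : p \in [pchar k]) (odd_p : odd p) (pT1 : p.-group [set: T1]).
Hypothesis (Dz1 : [set: T1]^`(1)%g = <[z1]>).
Let pr_p : prime p := pcharf_prime pcK.

Lemma galg_isom_pgroup : p.-group [set: T2].
Proof. by rewrite /pgroup -galg_isom_card. Qed.

Let y1 := ygen k z1.

(* I(T2')kT2 = w kT2 for w the image of z1 - 1; by nilpotency of the augmentation
   ideal some n - 1 with n in T2' is w times a unit. *)
Lemma galg_isom_der1_cyclic : exists z2, [set: T2]^`(1)%g = <[z2]>.
Proof.
have [fD fM f1 fZ _] := isof; have [f'D f'M f'1 f'Z _] := galg_isom_sym isof.
have fX a n : f (a ^+ n) = f a ^+ n by elim: n => [|n IH]; rewrite ?f1 // !exprS fM IH.
pose w := f y1; pose D2 := [set: T2]^`(1)%g.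
have nD2 : (D2 <| [set: T2])%g := der_normal 1 _.
have idD2 := relI_ideal k nD2.
have D2w a : relI D2 a -> exists b, a = w * b.
  rewrite -(f'K a) => /galg_isom_der1/(relI_der1_pfil Dz1)[b ->].
  by exists (f b); rewrite expr1 fM.
have nilp2 (b : galg k T2) : gaug b = 0 -> exists m, b ^+ m = 0.
  move=> b0; have : gaug (f' b) = 0.
    by rewrite (galg_isom_gaug (galg_isom_sym isof) _ pcK galg_isom_pgroup).
  case/(gaug0_nilp pcK pT1 Dz1) => m hm; exists m.
  by apply: (can_inj f'K); rewrite f'0 -hm; elim: m {hm} => [|m IH]; rewrite ?f'1 // !exprS f'M IH.
have : (exists n, n \in D2 /\ exists2 b, gd k n - 1 = w * b & gaug b != 0) \/
       (forall n, n \in D2 -> exists2 b, gd k n - 1 = w * b & gaug b = 0).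
  apply: exists_or_forall => n; have [Dn | Dn] := boolP (n \in D2); last by right.
  have [|b hb] := D2w (gd k n - 1); first exact/relI_gd1.
  have [b0 | nzb] := eqVneq (gaug b) 0; first by right=> _; exists b.
  by left; split=> //; exists b.
case=> [[n [Dn [u nE nzu]]] | wI].
  exists n; apply/eqP; rewrite eqEsubset cycle_subG Dn andbT.
  apply: (@relI_sub k _ [group of D2] [group of <[n]>]) => a /D2w[b ->].
  (* Divided by its augmentation, [u] is 1 minus a nilpotent element and is inverted by a geometric
     series. *)
  have [v uv] : exists v, u * v = 1.
    have [|m hm] := nilp2 (1 - (gaug u)^-1 *: u).
      by rewrite gaugB gaugZ -gd1 gaug_gd mulVf // subrr.
    have := geometric_unit hm; rewrite subKr => h.
    by exists ((gaug u)^-1 *: \sum_(i < m) (1 - (gaug u)^-1 *: u) ^+ i); rewrite -scalerAr scalerAl.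
  rewrite -[w]mulr1 -uv mulrA -nE -!mulrA; apply: relIMr.
  by apply/relI_gd1/cycle_id.
have wI' a : relI D2 a -> exists2 b, a = w * b & gaug b = 0.
  move: a; apply: (@relI_ind k _ [group of D2]) => [|_ _ [b -> b0] [c -> c0]|n c /wI[b -> b0]].
  - by exists 0; rewrite ?mulr0 // -(scale0r 0) gaugZ mul0r.
  - by exists (b + c); rewrite ?mulrDr // gaugD b0 c0 addr0.
  by exists (b * c); rewrite ?mulrA // gaugM b0 mul0r.
(* Here [w] is [w * b] with [b] nilpotent, so it vanishes and the derived subgroup of [T2] is
   trivial. *)
have w0 : w = 0.
  have [|b wE b0] := wI' w.
    by apply/galg_isom_der1/(relI_der1_pfil Dz1); exists 1; rewrite expr1 mulr1.
  have [m bm] := nilp2 b b0.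
  have : w = w * b ^+ m by elim: m {bm} => [|m IH]; rewrite ?mulr1 // exprS mulrA -wE.
  by rewrite bm mulr0.
exists 1%g; rewrite cycle1; apply/eqP; rewrite eqEsubset sub1G andbT.
apply: (@relI_sub k _ [group of D2] 1%G) => a /D2w[b ->].
by apply/relI1; rewrite w0 mul0r.
Qed.
End Cyclic.
End IsomCyclic.
End Transport.

Section SameCentralizer.
Local Open Scope group_scope.
Variables (p : nat) (T1 T2 : finGroupType).
Hypotheses (pr_p : prime p) (odd_p : odd p).
Hypotheses (pT1 : p.-group [set: T1]) (pT2 : p.-group [set: T2]).
Hypotheses (cycD1 : cyclic [set: T1]^`(1)) (cycD2 : cyclic [set: T2]^`(1)).
Hypothesis eq_root : forall s, #|root_group cycD1 (p ^ s)| = #|root_group cycD2 (p ^ s)|.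

Lemma leq_center_der1_exponent t1 t2 :
  #|'Z([set: T1]) :&: [set: T1]^`(1)| = (p ^ t1)%N ->
  #|'Z([set: T2]) :&: [set: T2]^`(1)| = (p ^ t2)%N -> (t2 <= t1)%N.
Proof.
move=> q1 q2; rewrite leqNgt; apply/negP=> lt12.
case: t2 q2 lt12 => // t2 q2; rewrite ltnS => le12.
have := index_root_group_gt pr_p odd_p pT2 cycD2 q2.
have := index_root_group_le pr_p odd_p pT1 cycD1 q1 le12.
rewrite -!divgS ?root_groupS // !eq_root => le_p gt_p.
by have := leq_trans gt_p le_p; rewrite ltnn.
Qed.
End SameCentralizer.

(** * Invariance of the centralizer ideal and of the power subgroups *)

Section Invariants.
Local Open Scope group_scope.
Local Open Scope ring_scope.
Variables (k : fieldType) (p : nat) (T1 T2 : finGroupType) (z1 : T1) (z2 : T2).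
Variables (f : galg k T1 -> galg k T2) (f' : galg k T2 -> galg k T1).
Hypotheses (pcK : p \in [pchar k]) (odd_p : odd p).
Hypotheses (pT1 : p.-group [set: T1]) (isof : galg_isom f f').
Hypotheses (Dz1 : [set: T1]^`(1)%g = <[z1]>) (Dz2 : [set: T2]^`(1)%g = <[z2]>).

Let pr_p : prime p := pcharf_prime pcK.
Let pT2 : p.-group [set: T2]. Proof. exact: (galg_isom_pgroup isof). Qed.
Let cycD1 : cyclic [set: T1]^`(1)%g. Proof. by rewrite Dz1 cycle_cyclic. Qed.
Let cycD2 : cyclic [set: T2]^`(1)%g. Proof. by rewrite Dz2 cycle_cyclic. Qed.
Let fD : {morph f : a b / a + b}. Proof. by case: isof. Qed.
Let fM : {morph f : a b / a * b}. Proof. by case: isof. Qed.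
Let f1 : f 1 = 1. Proof. by case: isof. Qed.
Let fZ c a : f (c *: a) = c *: f a. Proof. by case: isof. Qed.
Let fK : cancel f f'. Proof. by case: isof => _ _ _ _ []. Qed.
Let f'K : cancel f' f. Proof. by case: isof => _ _ _ _ []. Qed.
Let fX a n : f (a ^+ n) = f a ^+ n.
Proof. by elim: n => [|n IH]; rewrite ?f1 // !exprS fM IH. Qed.
Let fB b c : f (b - c) = f b - f c. Proof. by rewrite -scaleN1r fD fZ scaleN1r. Qed.

Local Notation D T := [set: T]^`(1)%g.
Local Notation C T := 'C_[set: T](D T)%g.
Local Notation ZD T := ('Z([set: T]) <*> D T)%g.
Local Notation U T j := (mhoP p j (C T)).
Local Notation Om T s := (root_set (ZD T) [set: T] (p ^ s)).

Let f_pfil w m a : pfil w m a <-> pfil (f w) m (f a).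
Proof.
split=> -[b h]; first by exists (f b); rewrite h fM fX.
by exists (f' b); apply: (can_inj fK); rewrite h fM fX f'K.
Qed.

Let f_ygen_normal : normal_elt (f (ygen k z1)).
Proof.
have [yl yr] := ygen_normal pcK pT1 Dz1; split=> b.
  by have [c hc] := yl (f' b); exists (f c); rewrite -{1}(f'K b) -!fM hc.
by have [c hc] := yr (f' b); exists (f c); rewrite -{1}(f'K b) -!fM hc.
Qed.

Lemma galg_isom_pfil m a : pfil (ygen k z1) m a <-> pfil (ygen k z2) m (f a).
Proof.
apply: iff_trans (f_pfil _ _ _) _.
apply: eq_pfil => // [|b]; first exact: (ygen_normal pcK pT2 Dz2).
apply: iff_trans _ (relI_der1_pfil Dz2 b).
rewrite -(f'K b); apply: iff_trans (iff_sym (f_pfil _ _ _)) _.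
apply: iff_trans (iff_sym (relI_der1_pfil Dz1 _)) _.
exact: (galg_isom_der1 isof).
Qed.

Lemma galg_isom_center_der1 a : relI (ZD T1) a <-> relI (ZD T2) (f a).
Proof.
apply: iff_trans (iff_sym (relI_center_der1 pcK pT1 a)) _.
apply: iff_trans _ (relI_center_der1 pcK pT2 (f a)).
apply: (galg_isom_ideal_gen isof) => {}a; rewrite /center_aug_or_comm.
rewrite (galg_isom_gaug isof _ pcK pT1); split=> -[[b [c h]]|[ca a0]].
- by left; exists (f b), (f c); rewrite h fB !fM.
- by right; split=> // b; rewrite -(f'K b) -!fM ca.
- by left; exists (f' b), (f' c); apply: (can_inj fK); rewrite fB !fM !f'K.
by right; split=> // b; apply: (can_inj fK); rewrite !fM ca.
Qed.

Lemma galg_isom_root s a : relI (Om T1 s) a <-> relI (Om T2 s) (f a).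
Proof.
apply: iff_trans (iff_sym (relI_root_set pcK pT1 Dz1 _ s (joing_subr _ _))) _.
apply: iff_trans _ (relI_root_set pcK pT2 Dz2 _ s (joing_subr _ _)).
by rewrite -fX; apply: galg_isom_center_der1.
Qed.

Lemma galg_isom_eq_card (N : {group T1}) (M : {group T2}) :
  (forall a, relI N a <-> relI M (f a)) -> #|N| = #|M|.
Proof.
move=> /(galg_isom_eq_index isof) eqi.
have := Lagrange (subsetT N); rewrite (galg_isom_card isof) -(Lagrange (subsetT M)) eqi.
by move/eqP; rewrite eqn_pmul2r ?indexg_gt0 // => /eqP.
Qed.

Lemma galg_isom_card_center_der1 :
  #|'Z([set: T1]) :&: D T1|%g = #|'Z([set: T2]) :&: D T2|%g.
Proof.
have eq_root s : #|root_group cycD1 (p ^ s)| = #|root_group cycD2 (p ^ s)|.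
  exact: (@galg_isom_eq_card (root_group cycD1 _) (root_group cycD2 _) (galg_isom_root s)).
have [t1 q1] := p_natP (pgroupS (subsetT _) pT1 : p.-group ('Z([set: T1]) :&: D T1)%g).
have [t2 q2] := p_natP (pgroupS (subsetT _) pT2 : p.-group ('Z([set: T2]) :&: D T2)%g).
rewrite q1 q2; congr (_ ^ _)%N; apply/eqP; rewrite eqn_leq.
by rewrite (leq_center_der1_exponent _ _ _ _ (fun s => esym (eq_root s)) q2 q1) //
           (leq_center_der1_exponent _ _ _ _ eq_root q1 q2).
Qed.

Lemma galg_isom_cent_der1 a : relI (C T1) a <-> relI (C T2) (f a).
Proof.
have [t q1] := p_natP (pgroupS (subsetT _) pT1 : p.-group ('Z([set: T1]) :&: D T1)%g).
have q2 := q1; rewrite galg_isom_card_center_der1 in q2.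
have := galg_isom_root t a.
have /= -> := sub_root_cent_der1 pr_p odd_p pT1 cycD1 q1.
by have /= -> := sub_root_cent_der1 pr_p odd_p pT2 cycD2 q2.
Qed.

Let f_pexp_or (I1 J1 : galg k T1 -> Prop) (I2 J2 : galg k T2 -> Prop) N :
  (forall a, I1 a <-> I2 (f a)) -> (forall a, J1 a <-> J2 (f a)) ->
  forall a, ideal_gen (pexp_or I1 J1 N) a <-> ideal_gen (pexp_or I2 J2 N) (f a).
Proof.
move=> fI fJ; apply: (galg_isom_ideal_gen isof) => a.
split=> -[[x Ix h]|/fJ Ja]; try by right.
  by left; exists (f x); [apply/fI | rewrite h fX].
by left; exists (f' x); [apply/fI; rewrite f'K | apply: (can_inj fK); rewrite h fX f'K].
Qed.

Lemma galg_isom_mho_der1 j a : relI (U T1 j <*> D T1) a <-> relI (U T2 j <*> D T2) (f a).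
Proof.
apply: iff_trans (iff_sym (relI_mho_der1 pcK odd_p pT1 Dz1 j a)) _.
apply: iff_trans _ (relI_mho_der1 pcK odd_p pT2 Dz2 j (f a)).
by apply: f_pexp_or => {}a; [apply: galg_isom_cent_der1 | apply: (galg_isom_der1 isof)].
Qed.

Let f_ygenX m : (exists b, f (ygen k z1 ^+ m) = ygen k z2 ^+ m * b) /\
                (exists b, ygen k z2 ^+ m = f (ygen k z1 ^+ m) * b).
Proof.
split; first by apply/galg_isom_pfil; exists 1; rewrite mulr1.
have : pfil (ygen k z2) m (f (f' (ygen k z2 ^+ m))) by rewrite f'K; exists 1; rewrite mulr1.
by case/galg_isom_pfil=> b hb; exists (f b); rewrite -fM -hb f'K.
Qed.

(** If [j <= a], both sides hold, the element being a [p ^ j]-th power in [D]. Otherwise membership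
    of [z ^+ (p ^ a)] is membership of [ygen k z ^+ (p ^ a)] in an invariant ideal; the image of
    this power for [z1] and the power for [z2] are right multiples of each other, so they lie in the
    same ideals. *)
Lemma galg_isom_mho_pexp j a :
  (z1 ^+ (p ^ a) \in U T1 j)%g = (z2 ^+ (p ^ a) \in U T2 j)%g.
Proof.
have [le_ja | lt_aj] := leqP j a.
  have mem (T : finGroupType) (z : T) : cyclic (D T) -> D T = <[z]>%g -> (z ^+ (p ^ a) \in U T j)%g.
    move=> cycD Dz; apply/(mhoP_cent_der1 odd_p cycD); exists (z ^+ (p ^ (a - j)))%g.
      by rewrite groupX // (subsetP (der1_sub_cent_der1 cycD)) // Dz cycle_id.
    by rewrite -expgM -expnD subnK.
  by rewrite !mem.
have id2 := ideal_gen_ideal (pexp_or (relI (C T2)) (pfil (ygen k z2) (p ^ j - p ^ j %/ p)) (p ^ j)).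
have key := f_pexp_or (p ^ j) galg_isom_cent_der1 (galg_isom_pfil _) (ygen k z1 ^+ (p ^ a)).
have [[b hb] [c hc]] := f_ygenX (p ^ a).
apply/idP/idP=> [/(mho_der1_pexp pcK odd_p pT1 Dz1 lt_aj)/key | ] Iy.
  apply/(mho_der1_pexp pcK odd_p pT2 Dz2 lt_aj); rewrite hc; exact: (is_idealMr id2).
apply/(mho_der1_pexp pcK odd_p pT1 Dz1 lt_aj)/key; rewrite hb; apply: (is_idealMr id2).
exact/(mho_der1_pexp pcK odd_p pT2 Dz2 lt_aj).
Qed.
End Invariants.

(** A subgroup of order [p ^ m] in a cyclic group of order [p ^ n] is generated by the
    [p ^ (n - m)]-th power of the generator. *)
Lemma card_cyclic_sub_leq p (T1 T2 : finGroupType) (z1 : T1) (z2 : T2)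
    (K1 : {group T1}) (K2 : {group T2}) : prime p ->
  (p.-elt z1)%g -> #[z1]%g = #[z2]%g -> K1 \subset <[z1]>%g ->
  (forall a, (z1 ^+ (p ^ a) \in K1)%g -> (z2 ^+ (p ^ a) \in K2)%g) -> #|K1| <= #|K2|.
Proof.
move=> pr_p pz oz sK1 K12; have [n on] := p_natP pz.
have [m om] := p_natP (pgroupS sK1 pz).
have le_mn : m <= n by rewrite -(leq_exp2l _ _ (prime_gt1 pr_p)) -on -om subset_leq_card.
have ord (T : finGroupType) (z : T) : #[z]%g = p ^ n -> #[z ^+ (p ^ (n - m))]%g = p ^ m.
  move=> oz'; rewrite orderXdiv oz' ?dvdn_exp2l ?leq_subr //.
  by rewrite -expnB ?prime_gt0 ?leq_subr // subKn.
have K1z : (z1 ^+ (p ^ (n - m)) \in K1)%g.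
  rewrite -cycle_subG -(cardSg_cyclic (cycle_cyclic z1)) ?cycle_subG ?mem_cycle //.
  by rewrite -orderE ord // om.
rewrite om -(ord _ z2) -?oz // orderE subset_leq_card // cycle_subG.
exact: K12.
Qed.

(** * Agemo subgroups and Jennings series *)

Section MhoJennings.
Local Open Scope group_scope.
Variables (p : nat).
Hypotheses (pr_p : prime p).
Implicit Type gT : finGroupType.

Lemma mhoP_sub gT j (X : {group gT}) : mhoP p j X \subset X.
Proof. by rewrite gen_subG; apply/subsetP=> _ /imsetP[x Xx ->]; rewrite groupX. Qed.

Lemma mhoP_le gT i j (X : {group gT}) : i <= j -> mhoP p j X \subset mhoP p i X.
Proof.
move=> le_ij; rewrite gen_subG; apply/subsetP=> _ /imsetP[x Xx ->].
apply: mem_gen; apply/imsetP; exists (x ^+ (p ^ (j - i))); first by rewrite groupX.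
by rewrite -expgM -expnD subnK.
Qed.

Lemma mhoP_morphim (aT rT : finGroupType) (E X : {group aT}) (f : {morphism E >-> rT}) j :
  X \subset E -> f @* mhoP p j X = mhoP p j (f @* X).
Proof.
move=> /subsetP sXE.
have sE : [set x ^+ (p ^ j) | x in X] \subset E.
  by apply/subsetP=> _ /imsetP[x Xx ->]; rewrite groupX ?sXE.
rewrite /mhoP morphim_gen //; congr <<_>>; apply/setP=> y; apply/idP/idP.
  case/morphimP=> _ _ /imsetP[x Xx ->] ->; apply/imsetP; exists (f x).
    by rewrite mem_morphim ?sXE.
  by rewrite morphX ?sXE.
case/imsetP=> _ /morphimP[x Ex Xx ->] ->; rewrite -morphX //.
by apply: mem_morphim; [rewrite groupX | apply: imset_f].
Qed.

Lemma cyclic_pgroup_subset gT (N K1 K2 : {group gT}) : p.-group N -> cyclic N ->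
  K1 \subset N -> K2 \subset N -> (#|K1| <= #|K2|)%N -> K1 \subset K2.
Proof.
move=> pN cycN s1 s2; rewrite -(cardSg_cyclic cycN) //.
have [a1 ->] := p_natP (pgroupS s1 pN); have [a2 ->] := p_natP (pgroupS s2 pN).
by rewrite leq_exp2l ?(prime_gt1 pr_p) //; apply: dvdn_exp2l.
Qed.

Lemma cyclic_pgroup_cardI gT (N K1 K2 : {group gT}) : p.-group N -> cyclic N ->
  K1 \subset N -> K2 \subset N -> #|K1 :&: K2| = minn #|K1| #|K2|.
Proof.
move=> pN cycN s1 s2; have [le12 | /ltnW le21] := leqP #|K1| #|K2|.
  by rewrite (setIidPl _) // (cyclic_pgroup_subset pN).
by rewrite (setIidPr _) // (cyclic_pgroup_subset pN).
Qed.

Lemma abelian_mhoP_card gT (X : {group gT}) n : p.-group X -> abelian X ->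
  (#|mhoP p n X| * #|'Ohm_n(X)|)%N = #|X|.
Proof.
move=> pX cXX.
have powM : {in X &, {morph (fun x => x ^+ (p ^ n)) : x y / x * y}}.
  by move=> x y Xx Xy; rewrite /= expgMn //; apply: (centsP cXX).
pose f := Morphism powM.
have -> : mhoP p n X = f @* X.
  by rewrite /mhoP -[RHS]gen_set_id ?groupP // morphimEdom.
have -> : 'Ohm_n(X) = 'ker f.
  rewrite (OhmEabelian pX) ?(abelianS (Ohm_sub _ _)) //.
  apply/setP=> x; rewrite !inE; case: (x \in X) => //=.
rewrite -(LagrangeI X ('ker f)) (setIidPr _) ?subsetIl //.
by rewrite card_morphim setIid mulnC.
Qed.

(** The multiplicity of [n.+1] is a difference of consecutive counts; these do not see 0, hence the
    positivity. *)
Lemma count_gt_perm_eq (s t : seq nat) : all (ltn 0) s -> all (ltn 0) t ->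
  (forall n, count (ltn n) s = count (ltn n) t) -> perm_eq s t.
Proof.
move=> s0 t0 st; apply/allP=> x _ /=; apply/eqP.
have cntS (u : seq nat) n : count (ltn n) u = (count_mem n.+1 u + count (ltn n.+1) u)%N.
  elim: u => //= m u ->; rewrite addnACA; congr (_ + _)%N.
  by rewrite [in LHS]leq_eqVlt eq_sym; case: eqP => [->|]; rewrite ?ltnn.
case: x => [|n]; last by apply: (@addIn (count (ltn n.+1) s)); rewrite {2}st -!cntS.
have cnt0 (u : seq nat) : all (ltn 0) u -> count_mem 0%N u = 0%N.
  by move=> u0; apply/eqP; rewrite -leqn0 leqNgt -has_count; apply/hasPn=> m /(allP u0); case: m.
by rewrite !cnt0.
Qed.

(** The orders of the power subgroups give those of the ['Ohm_n], and the indices of successive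
    ['Ohm_n] count the cyclic factors of order greater than [p ^ n]. *)
Lemma abelian_isog_mhoP (gT hT : finGroupType) (X : {group gT}) (Y : {group hT}) :
  p.-group X -> p.-group Y -> abelian X -> abelian Y ->
  (forall n, #|mhoP p n X| = #|mhoP p n Y|) -> X \isog Y.
Proof.
move=> pX pY cXX cYY eqU.
have mho0 (rT : finGroupType) (Z : {group rT}) : mhoP p 0 Z = Z.
  rewrite /mhoP -[RHS]gen_set_id ?groupP //; congr <<_>>.
  apply/setP=> x; apply/imsetP/idP=> [[z Zz ->] | Zx]; first by rewrite groupX.
  by exists x; rewrite ?expn0 ?expg1.
have eqXY : #|X| = #|Y| by have := eqU 0%N; rewrite !mho0.
have eqOhm n : #|'Ohm_n(X)| = #|'Ohm_n(Y)|.
  have := abelian_mhoP_card n pX cXX; rewrite eqXY -(abelian_mhoP_card n pY cYY) eqU.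
  by move/eqP; rewrite eqn_pmul2l ?cardG_gt0 // => /eqP.
rewrite eq_abelian_type_isog //.
have [b1 def1 type1] := abelian_structure cXX.
have [b2 def2 type2] := abelian_structure cYY.
have cnt n : count (fun m => n < logn p m)%N (abelian_type X) =
             count (fun m => n < logn p m)%N (abelian_type Y).
  rewrite -type1 -type2 !count_map.
  rewrite (count_logn_dprod_cycle p n def1) (count_logn_dprod_cycle p n def2).
  by rewrite -!divgS ?Ohm_leq // !eqOhm.
have pow (rT : finGroupType) (Z : {group rT}) b : p.-group Z ->
    \big[dprod/1]_(x <- b) <[x]> = Z -> map order b = abelian_type Z ->
    forall m, m \in abelian_type Z -> m = (p ^ logn p m)%N.
  move=> pZ defZ typeZ m Tm; rewrite -p_part part_pnat_id //.
  apply: pnat_dvd pZ; rewrite -(bigdprod_card defZ).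
  move: Tm; rewrite -typeZ => /mapP[x bx ->].
  by rewrite (big_rem x) //= dvdn_mulr // orderE.
have log_gt0 (rT : finGroupType) (Z : {group rT}) b : p.-group Z ->
    \big[dprod/1]_(x <- b) <[x]> = Z -> map order b = abelian_type Z ->
    all (ltn 0) (map (logn p) (abelian_type Z)).
  move=> pZ defZ typeZ; apply/allP=> _ /mapP[m Tm ->] /=.
  have := allP (abelian_type_gt1 Z) _ Tm; rewrite /= (pow _ _ _ pZ defZ typeZ _ Tm).
  by rewrite pfactorK //; case: (logn p m).
have perm_log : perm_eq (map (logn p) (abelian_type X)) (map (logn p) (abelian_type Y)).
  apply: count_gt_perm_eq => [||n]; last by rewrite !count_map; apply: cnt.
    exact: log_gt0 pX def1 type1.
  exact: log_gt0 pY def2 type2.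
apply/eqP; apply: (sorted_eq (leT := geq)); rewrite ?abelian_type_sorted //.
- by move=> a b c /= ba ac; apply: leq_trans ac ba.
- by move=> a b /andP[ab ba]; apply/eqP; rewrite eqn_leq; apply/andP.
have mapK (rT : finGroupType) (Z : {group rT}) b : p.-group Z ->
    \big[dprod/1]_(x <- b) <[x]> = Z -> map order b = abelian_type Z ->
    abelian_type Z = map (expn p) (map (logn p) (abelian_type Z)).
  move=> pZ defZ typeZ; rewrite -map_comp -[LHS]map_id; apply/eq_in_map=> m Tm.
  exact: pow pZ defZ typeZ _ Tm.
rewrite (mapK _ _ _ pX def1 type1) (mapK _ _ _ pY def2 type2).
exact: perm_map.
Qed.
End MhoJennings.

(** * Jennings series of the centralizer *)

Section JenningsQuotients.
Local Open Scope group_scope.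
Variables (p : nat) (gT : finGroupType) (G : {group gT}).
Hypotheses (pr_p : prime p) (odd_p : odd p).
Hypotheses (pG : p.-group G) (cycD : cyclic G^`(1)).

Local Notation D := G^`(1).
Local Notation C := 'C_G(D).
Local Notation U j := (mhoP p j C).
Local Notation V j := (mhoP p j C^`(1)).

Let sCG : C \subset G := subsetIl _ _.
Let p_gt1 : (1 < p)%N := prime_gt1 pr_p.
Let sC'Z : C^`(1) \subset 'Z(G).
Proof. by rewrite (der1_cent_der1 pr_p odd_p pG cycD) subsetIl. Qed.
Let sC'D : C^`(1) \subset D := dergS 1 sCG.

Let mem_V j x : (x \in V j) = (x \in [set d ^+ (p ^ j) | d in C^`(1)]).
Proof.
suff gV : group_set [set d ^+ (p ^ j) | d in C^`(1)] by rewrite /mhoP gen_set_id.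
apply/group_setP; split; first by apply/imsetP; exists 1; rewrite ?group1 ?expg1n.
move=> _ _ /imsetP[c Cc ->] /imsetP[d Cd ->]; apply/imsetP; exists (c * d).
  by rewrite groupM.
rewrite expgMn //; apply: (centsP (cyclic_abelian cycD)); exact: (subsetP sC'D).
Qed.

Let sVC' j : V j \subset C^`(1) := mhoP_sub p j [group of C^`(1)].
Let sVC j : V j \subset C := subset_trans (sVC' j) (der_sub 1 C).
Let sUC j : U j \subset C := mhoP_sub p j [group of C].
Let cVC j : C \subset 'C(V j).
Proof.
rewrite centsC (subset_trans (sVC' j)) // (subset_trans sC'Z) //.
by rewrite subIset // orbC centS.
Qed.

Let lcn_cent n : (2 < n)%N -> 'L_n(C) = 1.
Proof.
case: n => [|[|[|n]]] // _; rewrite lcnSn; apply/commG1P.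
have -> : 'L_n.+2(C) \subset 'C(C) = true; last by [].
apply: subset_trans (_ : 'Z(G) \subset _); last by rewrite subIset // orbC centS.
apply: subset_trans sC'Z; elim: n => // n IH.
by rewrite lcnSn; apply: subset_trans (commSg _ IH) _; rewrite commg_subl der_norm.
Qed.

(** Class at most 2 leaves only the factors [i = 1] and [i = 2]. Their least admissible [j] come
    from n <= p^j and n <= 2p^j, the latter meaning [uphalf n <= p ^ j]. *)
Lemma jennings_cent_der1 n : (0 < n)%N ->
  jennings p n C = U (up_log p n) <*> V (up_log p (uphalf n)).
Proof.
move=> n0; apply/eqP; rewrite eqEsubset; apply/andP; split.
  rewrite gen_subG; apply/bigcupsP=> -[i /= lt_in] i0; apply/bigcupsP=> -[j /= lt_jn] nij.
  case: i lt_in i0 nij => [|[|[|i]]] // lt_in _ nij.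
  - apply: subset_trans (joing_subl _ _); rewrite lcn1; apply: mhoP_le.
    by apply: up_log_min; rewrite // -[X in (_ <= X)%N]mul1n.
  - apply: subset_trans (joing_subr _ _); apply: (@mhoP_le p _ _ _ [group of C^`(1)]).
    by apply: up_log_min; rewrite // leq_uphalf_double -mul2n.
  rewrite (@lcn_cent i.+3) // gen_subG; apply/subsetP=> _ /imsetP[x /set1P-> ->].
  by rewrite expg1n group1.
have up_n m : (m <= n -> up_log p m <= n)%N.
  by move=> le_mn; apply: up_log_min => //; apply: leq_trans le_mn (ltnW (ltn_expl _ _)).
rewrite join_subG; apply/andP; split.
  apply: sub_gen.
  have i1 : (1 < n.+1)%N by [].
  have j1 : (up_log p n < n.+1)%N by rewrite ltnS up_n.
  apply: (bigcup_max (Ordinal i1)) => //; apply: (bigcup_max (Ordinal j1)) => /=.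
    by rewrite mul1n up_logP.
  by rewrite lcn1.
(* For [n = 1] the index [i = 2] is out of range, but [V 0] is already contained in the factor
   [i = 1], [j = 0], which is [C]. *)
have [-> | n1] := eqVneq n 1%N.
  apply: subset_trans (sVC _) _; apply: sub_gen.
  apply: (bigcup_max (Ordinal (isT : (1 < 2)%N))) => //.
  apply: (bigcup_max (Ordinal (isT : (0 < 2)%N))) => //=.
  rewrite lcn1; apply/subsetP=> x Cx; by apply: mem_gen; apply/imsetP; exists x.
apply: sub_gen.
have i2 : (2 < n.+1)%N by rewrite ltnS ltn_neqAle eq_sym n1.
have j2 : (up_log p (uphalf n) < n.+1)%N.
  by rewrite ltnS up_n // -{2}(odd_double_half n) uphalf_half leq_add2l -addnn leq_addr.
apply: (bigcup_max (Ordinal i2)) => //; apply: (bigcup_max (Ordinal j2)) => //=.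
by rewrite mul2n -leq_uphalf_double up_logP.
Qed.

Local Notation DN n := (U (up_log p n) <*> V (up_log p (uphalf n))).

Let memDN n x : x \in DN n ->
  exists c d, [/\ c \in C, d \in C^`(1) & x = c ^+ (p ^ up_log p n) * d ^+ (p ^ up_log p (uphalf n))].
Proof.
rewrite cent_joinEr; last by rewrite centsC (subset_trans (sUC _) (cVC _)).
case/mulsgP=> u v Uu Vv ->; have [c Cc ->] := mhoP_cent_der1 odd_p cycD _ _ Uu.
move: Vv; rewrite mem_V => /imsetP[d Dd ->].
by exists c, d.
Qed.

Let sDNC n : DN n \subset C. Proof. by rewrite join_subG sUC sVC. Qed.

Let nDNC n : C \subset 'N(DN n).
Proof.
apply: normsY; first exact: (subset_trans sCG (mho_cent_der1_norm odd_p cycD _)).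
exact: (subset_trans (cVC _) (cent_sub _)).
Qed.

Let up_S n : (0 < n)%N ->
  [/\ up_log p n.+1 <= (up_log p n).+1, up_log p (uphalf n.+1) <= (up_log p (uphalf n)).+1
    & up_log p (uphalf n.+1) <= up_log p n]%N.
Proof.
move=> n0; have le_n := up_logP n p_gt1; have le_h := up_logP (uphalf n) p_gt1.
rewrite leq_uphalf_double -mul2n in le_h.
split; apply: up_log_min => //; rewrite ?leq_uphalf_double -?mul2n ?expnS.
- by move: p_gt1 le_n; nia.
- by move: p_gt1 le_h; nia.
by move: le_n; lia.
Qed.

(** Elements are [c ^+ (p ^ a) * d ^+ (p ^ b)] with [d] central. Their commutators are [p ^ a]-th
    powers of commutators, so they lie in [V a], and [a = up_log p n] is large enough for level
    [n.+1]. A [p]-th power raises both exponents by one, which also suffices. *)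
Lemma jennings_quo_abelem n : (0 < n)%N -> p.-abelem (DN n / DN n.+1).
Proof.
move=> n0; have [leU leV leVU] := up_S n0.
have nDN : DN n \subset 'N(DN n.+1) := subset_trans (sDNC n) (nDNC n.+1).
apply/abelemP=> //; split.
  apply: quotient_cents2r; rewrite gen_subG; apply/subsetP=> _ /imset2P[x y DNx DNy ->].
  have Cy := subsetP (sDNC _) _ DNy; have Gy := subsetP sCG _ Cy.
  have [c [d [Cc C'd ->]]] := memDN DNx.
  have Vd : d ^+ (p ^ up_log p (uphalf n)) \in V (up_log p (uphalf n)).
    by rewrite mem_V; apply/imsetP; exists d.
  rewrite (commMg_cent_der1 _ _ Gy) ?groupX //; last exact: (subsetP (der_sub 1 C)).
  rewrite (commXg_cent_der1 _ Cc Gy).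
  have /commgP/eqP -> : commute (d ^+ (p ^ up_log p (uphalf n))) y.
    by apply: commute_sym; apply: (centP (subsetP (cVC _) _ Cy) _ Vd).
  rewrite mulg1; apply: (subsetP (joing_subr _ _)).
  apply: (subsetP (mhoP_le p [group of C^`(1)] leVU)).
  by rewrite mem_V; apply/imsetP; exists [~ c, y]; rewrite // mem_commg.
move=> _ /morphimP[x Nx DNx ->]; rewrite -morphX //=; apply: coset_id.
have [c [d [Cc C'd ->]]] := memDN DNx.
have cd : commute (c ^+ (p ^ up_log p n)) (d ^+ (p ^ up_log p (uphalf n))).
  apply/commuteX/commute_sym/commuteX/commute_sym.
  have /setIP[_ /centP cd] := subsetP sC'Z _ C'd.
  by apply: commute_sym; apply: cd; apply: (subsetP sCG).
rewrite expgMn // -!expgM -!expnSr groupM //.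
  apply: (subsetP (joing_subl _ _)); apply: (subsetP (mhoP_le p [group of C] leU)).
  by apply/mem_gen/imsetP; exists c.
apply: (subsetP (joing_subr _ _)); apply: (subsetP (mhoP_le p [group of C^`(1)] leV)).
by apply/mem_gen/imsetP; exists d.
Qed.

Lemma jennings_succ_normal n : DN n.+1 <| DN n.
Proof.
rewrite /normal (subset_trans (sDNC n) (nDNC n.+1)) andbT.
apply: genS; apply: setUSS; [apply: (mhoP_le p [group of C]) | apply: (mhoP_le p [group of C^`(1)])].
  exact: leq_up_log.
by apply: leq_up_log; apply: uphalf_leq.
Qed.

(** The intersection of [U a] and [V b] is that of [U a :&: D] with [V b], two members of the chain
    of subgroups of [D]; its order is the smaller one. *)
Lemma card_jennings a b :
  (#|U a <*> V b| * minn #|U a :&: D| #|V b| = #|U a| * #|V b|)%N.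
Proof.
rewrite cent_joinEr; last by rewrite centsC (subset_trans (sUC _) (cVC _)).
rewrite mul_cardG; congr (_ * _)%N.
have -> : U a :&: V b = (U a :&: D) :&: V b.
  by rewrite -setIA [D :&: _](setIidPr _) // (subset_trans (sVC' b)).
rewrite (@cyclic_pgroup_cardI p pr_p _ [group of D] [group of U a :&: D] [group of V b]) //.
- exact: pgroupS (der_sub 1 G) pG.
- exact: subsetIr.
exact: subset_trans (sVC' b) sC'D.
Qed.

Lemma card_mho_cent_der1 j : (#|U j| * #|D| = #|U j <*> D| * #|U j :&: D|)%N.
Proof.
by rewrite norm_joinEl ?mul_cardG // (subset_trans (sUC j)) // (subset_trans sCG) ?der_norm.
Qed.
End JenningsQuotients.

(** * The orders determine exponent, quotients and Jennings factors *)

Section NumericalInvariants.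
Local Open Scope group_scope.
Variables (p : nat) (gT hT : finGroupType) (G : {group gT}) (H : {group hT}).
Hypotheses (pr_p : prime p) (odd_p : odd p).
Hypotheses (pG : p.-group G) (cycG : cyclic G^`(1)).
Hypotheses (pH : p.-group H) (cycH : cyclic H^`(1)).

Local Notation C G := 'C_G(G^`(1)).
Local Notation U G j := (mhoP p j (C G)).
Local Notation V G j := (mhoP p j (C G)^`(1)).

Hypotheses (eqC : #|C G| = #|C H|) (eqD : #|G^`(1)| = #|H^`(1)|).
Hypothesis eqZ : #|'Z(G) :&: G^`(1)| = #|'Z(H) :&: H^`(1)|.
Hypothesis eqUD : forall j, #|U G j <*> G^`(1)| = #|U H j <*> H^`(1)|.
Hypothesis eqUI : forall j, #|U G j :&: G^`(1)| = #|U H j :&: H^`(1)|.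

Lemma eq_card_mho j : #|U G j| = #|U H j|.
Proof.
have := card_mho_cent_der1 p G j; rewrite eqUD eqUI eqD -card_mho_cent_der1.
by move/eqP; rewrite eqn_pmul2r ?cardG_gt0 // => /eqP.
Qed.

Let eqC' : #|(C G)^`(1)| = #|(C H)^`(1)|.
Proof. by rewrite !(der1_cent_der1 pr_p odd_p). Qed.

Let cycC' rT (K : {group rT}) : cyclic K^`(1) -> cyclic (C K)^`(1).
Proof. by apply: cyclicS; rewrite dergS ?subsetIl. Qed.

Lemma eq_card_mho_der1 j : #|V G j| = #|V H j|.
Proof.
have /isogP[f injf imf] : (C G)^`(1) \isog (C H)^`(1).
  by rewrite isog_cyclic_card ?cycC' //= eqC'.
rewrite -imf -mhoP_morphim // card_injm //.
exact: mhoP_sub.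
Qed.

Lemma eq_card_jennings a b : #|U G a <*> V G b| = #|U H a <*> V H b|.
Proof.
have := card_jennings pr_p odd_p pG cycG a b.
rewrite eqUI eq_card_mho eq_card_mho_der1 -(card_jennings pr_p odd_p pH cycH a b).
move/eqP; rewrite eqn_pmul2r; first by move/eqP.
by rewrite leq_min !cardG_gt0.
Qed.

Lemma jennings_quo_isog n : (0 < n)%N ->
  jennings p n (C G) / jennings p n.+1 (C G) \isog jennings p n (C H) / jennings p n.+1 (C H).
Proof.
move=> n0; rewrite !(jennings_cent_der1 pr_p odd_p) //.
rewrite (isog_abelem_card _ (jennings_quo_abelem pr_p odd_p pG cycG n0)).
rewrite (jennings_quo_abelem pr_p odd_p pH cycH n0) /=.
have normG := jennings_succ_normal pr_p odd_p pG cycG n.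
have normH := jennings_succ_normal pr_p odd_p pH cycH n.
rewrite !card_quotient ?normal_norm //.
by rewrite -!divgS ?normal_sub // !eq_card_jennings.
Qed.

Let exponent_dvd (rT : finGroupType) (K : {group rT}) j :
  (exponent (C K) %| p ^ j) = (#|U K j| == 1%N).
Proof.
rewrite -trivg_card1; apply/exponentP/eqP => [expC | U1 x Cx].
  apply/trivgP; rewrite gen_subG; apply/subsetP=> _ /imsetP[x Cx ->].
  by rewrite expC // inE.
have : x ^+ (p ^ j) \in U K j by apply/mem_gen/imsetP; exists x.
by rewrite U1 => /set1P.
Qed.

Lemma exponent_cent_der1_eq : exponent (C G) = exponent (C H).
Proof.
have expP (rT : finGroupType) (K : {group rT}) : p.-group K -> exists e, exponent (C K) = (p ^ e)%N.
  move=> pK; have : p.-nat (exponent (C K)).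
    exact: pnat_dvd (exponent_dvdn _) (pgroupS (subsetIl _ _) pK).
  by case/p_natP=> e eE; exists e.
have [e1 e1E] := expP _ _ pG; have [e2 e2E] := expP _ _ pH.
apply/eqP; rewrite eqn_dvd {1}e2E exponent_dvd eq_card_mho -exponent_dvd -e2E dvdnn /=.
by rewrite e1E exponent_dvd -eq_card_mho -exponent_dvd -e1E dvdnn.
Qed.

Let quo_card (rT : finGroupType) (K : {group rT}) (N : {group rT}) j : C K \subset 'N(N) ->
  #|mhoP p j (C K / N)| = (#|U K j| %/ #|U K j :&: N|)%N.
Proof.
move=> nN; rewrite -mhoP_morphim // -/(_ / _) divgI card_quotient //.
exact: subset_trans (mhoP_sub _ _ _) nN.
Qed.

Let nCD (rT : finGroupType) (K : {group rT}) : C K \subset 'N(K^`(1)).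
Proof. by rewrite (subset_trans (subsetIl _ _)) ?der_norm. Qed.

Lemma cent_der1_quo_der1_isog : C G / G^`(1) \isog C H / H^`(1).
Proof.
have abel (rT : finGroupType) (K : {group rT}) : abelian (C K / K^`(1)).
  apply: quotient_cents2r; rewrite (subset_trans _ (dergS 1 (subsetIl K 'C(K^`(1))))) //.
apply: (abelian_isog_mhoP (p := p)) => //.
- by rewrite quotient_pgroup // (pgroupS (subsetIl _ _)).
- by rewrite quotient_pgroup // (pgroupS (subsetIl _ _)).
by move=> n; rewrite !quo_card ?nCD // eq_card_mho eqUI.
Qed.

Lemma cent_der1_abelianization_isog :
  C G / (C G)^`(1) \isog C H / (C H)^`(1).
Proof.
have cardI (rT : finGroupType) (K : {group rT}) j : p.-group K -> cyclic K^`(1) ->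
    #|U K j :&: (C K)^`(1)| = minn #|U K j :&: K^`(1)| #|(C K)^`(1)|.
  move=> pK cycK; have sC'D : (C K)^`(1) \subset K^`(1) by rewrite dergS ?subsetIl.
  rewrite -{1}(setIidPr sC'D) setIA.
  rewrite (@cyclic_pgroup_cardI p pr_p _ [group of K^`(1)] [group of U K j :&: K^`(1)]
            [group of (C K)^`(1)]) ?subsetIr //.
  exact: pgroupS (der_sub 1 K) pK.
apply: (abelian_isog_mhoP (p := p)) => //; rewrite ?der_abelian //.
- by rewrite quotient_pgroup // (pgroupS (subsetIl _ _)).
- by rewrite quotient_pgroup // (pgroupS (subsetIl _ _)).
by move=> n; rewrite !quo_card ?der_norm // !cardI // eq_card_mho eqUI eqC'.
Qed.
End NumericalInvariants.

(** * Passing to the subgroup type *)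

Section SubgTransfer.
Local Open Scope group_scope.
Variables (p : nat) (gT : finGroupType) (G : {group gT}).

Local Notation T := [set: subg_of G].
Local Notation sg := (sgval_morphism G).

Let imT : sg @* T = G. Proof. exact: im_sgval. Qed.
Let imD : sg @* T^`(1) = G^`(1). Proof. by rewrite morphim_der ?imT ?subsetT. Qed.

Lemma sgval_cent_der1 : sgval @* 'C_T(T^`(1)) = 'C_G(G^`(1)).
Proof. by rewrite injm_subcent ?injm_sgval ?subsetT //= imT imD. Qed.

Lemma card_subg_cent_der1 : #|'C_T(T^`(1))| = #|'C_G(G^`(1))|.
Proof. by rewrite -sgval_cent_der1 card_injm ?injm_sgval ?subsetT. Qed.

Lemma card_subg_der1 : #|T^`(1)| = #|G^`(1)|.
Proof. by rewrite -imD card_injm ?injm_sgval ?subsetT. Qed.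

Lemma card_subg_center_der1 : #|'Z(T) :&: T^`(1)| = #|'Z(G) :&: G^`(1)|.
Proof.
have imZ : sg @* 'Z(T) = 'Z(G) by rewrite injm_center ?injm_sgval ?subsetT //= imT.
by rewrite -imD -imZ -injmI ?injm_sgval ?subsetT // card_injm ?injm_sgval ?subsetT.
Qed.

Lemma card_subg_mho_joing j :
  #|mhoP p j 'C_T(T^`(1)) <*> T^`(1)| = #|mhoP p j 'C_G(G^`(1)) <*> G^`(1)|.
Proof.
rewrite -sgval_cent_der1 -mhoP_morphim ?subsetT // -imD -morphimY ?subsetT //.
by rewrite card_injm ?injm_sgval ?subsetT.
Qed.

Lemma card_subg_mho_setI j :
  #|mhoP p j 'C_T(T^`(1)) :&: T^`(1)| = #|mhoP p j 'C_G(G^`(1)) :&: G^`(1)|.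
Proof.
rewrite -sgval_cent_der1 -mhoP_morphim ?subsetT // -imD -injmI ?injm_sgval ?subsetT //.
by rewrite card_injm ?injm_sgval ?subsetT.
Qed.

Lemma subg_der1_cyclic : cyclic G^`(1) = cyclic T^`(1).
Proof. by rewrite -imD injm_cyclic ?injm_sgval ?subsetT. Qed.

Lemma subg_pgroup : p.-group T = p.-group G.
Proof. by rewrite /pgroup -(card_injm (injm_sgval G) (subsetT T)) imT. Qed.
End SubgTransfer.

Section Extension.
Local Open Scope ring_scope.
Variables (k : fieldType) (gT : finGroupType) (G : {group gT}).
Local Notation A := (galg k (subg_of G)).
Implicit Types (a b : A) (c d : gfun k gT).

(** Extension by zero identifies the full group algebra of the type [subg_of G], where the ring
    structure is available, with the functions supported in [G]. *)
Definition extG a : gfun k gT := [ffun x => if x \in G then a (subg G x) else 0].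
Definition resG c : A := [ffun u => c (sgval u)].

Lemma extGK : cancel extG resG.
Proof. by move=> a; apply/ffunP=> u; rewrite !ffunE subgP sgvalK. Qed.

Lemma in_galg_ext a : in_galg G (extG a).
Proof. by move=> x /negPf xG; rewrite ffunE xG. Qed.

Lemma resGK c : in_galg G c -> extG (resG c) = c.
Proof.
move=> Gc; apply/ffunP=> x; rewrite ffunE; case: ifP => [Gx | /negbT/Gc //].
by rewrite ffunE subgK.
Qed.

Lemma extGD a b : extG (a + b) = extG a + extG b.
Proof. by apply/ffunP=> x; rewrite !ffunE; case: ifP; rewrite ?addr0. Qed.

Lemma extGZ r a : extG (r *: a) = gscale r (extG a).
Proof. by apply/ffunP=> x; rewrite !ffunE; case: ifP; rewrite ?mulr0. Qed.

Lemma extG_gd g : extG (gd k g) = gdelta k (sgval g).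
Proof.
apply/ffunP=> x; rewrite !ffunE; case: ifP => [Gx | /negbT xG].
  by rewrite -(inj_eq val_inj) /= subgK.
by case: eqP xG => // ->; rewrite subgP.
Qed.

Lemma big_subg (F : gT -> k) : (forall x, x \notin G -> F x = 0) ->
  \sum_x F x = \sum_(u : subg_of G) F (sgval u).
Proof.
move=> F0; rewrite (bigID (mem G)) /= addrC big1 ?add0r => [|x /F0 //].
rewrite (reindex (fun u : subg_of G => sgval u)) /=; first by apply: eq_bigl => u; rewrite subgP.
by exists (subg G) => [u _ | x Gx]; rewrite ?sgvalK ?subgK.
Qed.

Lemma extGM a b : extG (a * b) = gconv (extG a) (extG b).
Proof.
apply/ffunP=> x; rewrite ffunE [in RHS]ffunE big_subg => [|y /negPf yG]; last first.
  by rewrite ffunE yG mul0r.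
have [Gx | xG] := ifP.
  rewrite galg_mulE; apply: eq_bigr => u _; rewrite !ffunE subgP sgvalK groupMl ?groupV ?subgP // Gx.
  congr (_ * b _); apply: val_inj; rewrite /= !subgK ?groupM ?groupV ?subgP //.
rewrite big1 // => u _; rewrite [X in _ * X]ffunE groupMl ?groupV ?subgP // xG mulr0.
by [].
Qed.

(** This links the finite sums of products to the vanishing of coset sums. A witness for the
    converse is the decomposition of [relI_sum], with one summand for each element of
    [subg_of G]. *)
Lemma rel_aug_idealP (N : {group gT}) (M : {group subg_of G}) c :
  (sgval @* M)%g = N -> rel_aug_ideal N G c <-> in_galg G c /\ relI M (resG c).
Proof.
move=> imM.
have memM u : (sgval u \in N) = (u \in M).
  by rewrite -imM; apply/idP/idP=> [/morphimP[v _ Mv /val_inj->] // | Mu]; rewrite mem_morphim ?inE.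
have sNG : N \subset G.
  by apply/subsetP=> x; rewrite -imM => /morphimP[u _ _ ->]; apply: subgP.
split=> [[m [u [v [Nu Gv ->]]]] | [Gc Mc]].
  have Gu i : in_galg G (u i).
    by move=> x xG; apply: (Nu i).1; apply: contra xG; apply: (subsetP sNG).
  have sum_ext : \sum_(i < m) gconv (u i) (v i) = extG (\sum_(i < m) resG (u i) * resG (v i)).
    rewrite (big_morph extG extGD (_ : _ = 0)); last first.
      by apply/ffunP=> x; rewrite !ffunE; case: ifP.
    by apply: eq_bigr => i _; rewrite extGM !resGK.
  rewrite sum_ext extGK; split; first exact: in_galg_ext.
  move=> x; rewrite csum_sum big1 // => i _.
  suff : relI M (resG (u i)) by move=> Mu; apply: relIMr.
  move=> {}x; rewrite /csum; have [Mx | Mx] := boolP (x \in M).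
    have [Nui ui0] := Nu i; rewrite -[RHS]ui0 /gaug big_subg => [|y /Gu //].
    rewrite [RHS](bigID (mem M)) /= [X in _ + X]big1 ?addr0; last first.
      by move=> y My; apply: Nui; rewrite memM.
    rewrite [RHS](reindex_inj (mulIg x)) /=; apply: eq_big => y; first by rewrite groupMr.
    by rewrite ffunE.
  rewrite big1 // => y My; rewrite ffunE; apply: (Nu i).1.
  by rewrite memM groupMl.
pose r x := repr (M :* x)%g.
exists #|{: subg_of G}|,
  (fun i => extG (gd k (enum_val i * (r (enum_val i))^-1)%g - 1)),
  (fun i => extG (resG c (enum_val i) *: gd k (r (enum_val i)))).
split=> [i | i |]; [|exact: in_galg_ext|].
  set x := enum_val i; have Mx : (x * (r x)^-1)%g \in M.
    by rewrite -mem_rcoset rcoset_sym; apply: mem_repr_rcoset.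
  split=> [y Ny|].
    rewrite ffunE; case: ifP => // Gy; rewrite -scaleN1r gaddE gscaleE -gd1 !gdE.
    have {}Ny : subg G y \notin M by rewrite -memM subgK.
    have ne u : u \in M -> (subg G y == u) = false.
      by move=> Mu; apply/negbTE; apply: contra Ny => /eqP->.
    by rewrite !ne ?group1 // mulr0 addr0.
  rewrite /gaug big_subg => [|y]; last exact: in_galg_ext.
  rewrite -[RHS](subrr 1) -{1}(gaug_gd k (x * (r x)^-1)%g) -(gaug_gd k (1%g : subg_of G)) -gaugB.
  by apply: eq_bigr => u _; rewrite ffunE subgP sgvalK.
rewrite -{1}(resGK Gc) {1}(relI_sum Mc) (big_morph extG extGD (_ : _ = 0)); last first.
  by apply/ffunP=> x; rewrite !ffunE; case: ifP.
rewrite (eq_bigl (mem {: subg_of G})) // big_enum_val.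
by apply: eq_bigr => i _; rewrite -extGM scalerAr.
Qed.
End Extension.

Section GroupAlgebraIsomorphism.
Local Open Scope ring_scope.
Variables (k : fieldType) (gT hT : finGroupType) (G : {group gT}) (H : {group hT}).
Variable phi : gfun k gT -> gfun k hT.
Hypothesis iso_phi : galg_iso G H phi.

Definition subg_iso (a : galg k (subg_of G)) : galg k (subg_of H) := resG H (phi (extG a)).

Let phi_in a : in_galg G a -> in_galg H (phi a).
Proof. by have [[phi_in _] _ _ _] := iso_phi; apply: phi_in. Qed.

Lemma extG_subg_iso a : extG (subg_iso a) = phi (extG a).
Proof. by rewrite resGK //; apply/phi_in/in_galg_ext. Qed.

Lemma subg_iso_isom : exists f', galg_isom subg_iso f'.
Proof.
have [[_ [phi_inj phi_surj]] phi_lin phi_mul phi_one] := iso_phi.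
have gscale_1 (T : finGroupType) (a : gfun k T) : gscale 1 a = a.
  by apply/ffunP=> x; rewrite ffunE mul1r.
have phiD a b : in_galg G a -> in_galg G b -> phi (a + b) = phi a + phi b.
  by move=> Ga Gb; rewrite -{1}(gscale_1 _ a) phi_lin // gscale_1.
have in0 : in_galg G (0 : gfun k gT) by move=> x _; rewrite ffunE.
have phi0 : phi 0 = 0.
  by apply: (addrI (phi 0)); rewrite -phiD // !addr0.
have fD : {morph subg_iso : a b / a + b}.
  move=> a b; apply: (can_inj (@extGK k _ H)).
  by rewrite extGD !extG_subg_iso extGD phiD //; apply: in_galg_ext.
have fM : {morph subg_iso : a b / a * b}.
  move=> a b; apply: (can_inj (@extGK k _ H)).
  by rewrite extGM !extG_subg_iso extGM phi_mul //; apply: in_galg_ext.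
have f1 : subg_iso 1 = 1.
  by apply: (can_inj (@extGK k _ H)); rewrite extG_subg_iso -!gd1 !extG_gd phi_one.
have fZ c a : subg_iso (c *: a) = c *: subg_iso a.
  apply: (can_inj (@extGK k _ H)); rewrite extGZ !extG_subg_iso extGZ.
  rewrite -[gscale c _]addr0 phi_lin ?phi0 ?addr0 //; exact: in_galg_ext.
have f_inj : injective subg_iso.
  move=> a b eq_ab; apply: (can_inj (@extGK k _ G)); apply: phi_inj; [exact: in_galg_ext.. |].
  by rewrite -!extG_subg_iso eq_ab.
have f_surj b : exists a, subg_iso a == b.
  have [a Ga phia] := phi_surj _ (in_galg_ext b).
  by exists (resG G a); apply/eqP; rewrite /subg_iso resGK // phia extGK.
(* Surjectivity was stated with a boolean equality so that a preimage can be chosen. *)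
exists (fun b => xchoose (f_surj b)); split=> //.
have fK b : subg_iso (xchoose (f_surj b)) = b by apply/eqP/(xchooseP (f_surj b)).
by split=> // a; apply: f_inj; rewrite fK.
Qed.

Lemma relI_subg_iso (N : {group gT}) (M : {group hT})
    (N' : {group subg_of G}) (M' : {group subg_of H}) :
  (sgval @* N')%g = N -> (sgval @* M')%g = M ->
  (forall a, relI N' a <-> relI M' (subg_iso a)) ->
  (forall a, rel_aug_ideal N G a -> rel_aug_ideal M H (phi a)) /\
  (forall b, rel_aug_ideal M H b -> exists2 a, rel_aug_ideal N G a & phi a = b).
Proof.
move=> imN imM NM; have [f' [_ _ _ _ [_ f'K]]] := subg_iso_isom.
split=> [a /(rel_aug_idealP _ imN)[Ga Na] | b /(rel_aug_idealP _ imM)[Hb Mb]].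
  apply/(rel_aug_idealP _ imM); split; first exact: phi_in.
  by rewrite -(resGK Ga) -/(subg_iso _); apply/NM.
exists (extG (f' (resG H b))); last by rewrite -extG_subg_iso f'K resGK.
apply/(rel_aug_idealP _ imN); split; first exact: in_galg_ext.
by rewrite extGK; apply/NM; rewrite f'K.
Qed.
End GroupAlgebraIsomorphism.

Theorem theorem4p2 (k : fieldType) (p : nat) (gT hT : finGroupType)
    (G : {group gT}) (H : {group hT}) :
  prime p -> odd p -> (p \in [pchar k])%R ->
  (p.-group G)%g -> cyclic (G^`(1))%g ->
  (exists phi : gfun k gT -> gfun k hT, galg_iso G H phi) ->
  [/\ (forall phi : gfun k gT -> gfun k hT,
         galg_iso G H phi -> preserves_aug G phi ->
         (forall a, rel_aug_ideal ('C_G(G^`(1)))%g G a ->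
                    rel_aug_ideal ('C_H(H^`(1)))%g H (phi a)) /\
         (forall b, rel_aug_ideal ('C_H(H^`(1)))%g H b ->
            exists2 a, rel_aug_ideal ('C_G(G^`(1)))%g G a & phi a = b)),
      (forall i : nat, (0 < i)%N ->
         (jennings p i ('C_G(G^`(1))) / jennings p i.+1 ('C_G(G^`(1))))%g
         \isog
         (jennings p i ('C_H(H^`(1))) / jennings p i.+1 ('C_H(H^`(1))))%g),
      exponent ('C_G(G^`(1)))%g = exponent ('C_H(H^`(1)))%g,
      ('C_G(G^`(1)) / G^`(1))%g \isog ('C_H(H^`(1)) / H^`(1))%g
    & ('C_G(G^`(1)) / ('C_G(G^`(1)))^`(1))%g
        \isog ('C_H(H^`(1)) / ('C_H(H^`(1)))^`(1))%g].
Proof.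
move=> pr_p odd_p pcK pG cycG iso_GH.
have pT1 : (p.-group [set: subg_of G])%g by rewrite (subg_pgroup p G).
have /cyclicP[z1 Dz1] : cyclic [set: subg_of G]^`(1)%g by rewrite -(subg_der1_cyclic G).
have [phi0 iso_phi0] := iso_GH; have [f' isof] := subg_iso_isom iso_phi0.
have [z2 Dz2] := galg_isom_der1_cyclic isof pcK pT1 Dz1.
have pH : (p.-group H)%g by rewrite -(subg_pgroup p H) (galg_isom_pgroup isof).
have cycH : cyclic H^`(1)%g by rewrite (subg_der1_cyclic H) Dz2 cycle_cyclic.
(* The first claim concerns every isomorphism, so this is proved for arbitrary [phi]; [z2], although
   obtained from [phi0], enters only as a generator of the derived subgroup. *)
have relC (phi : gfun k gT -> gfun k hT) (iso_phi : galg_iso G H phi) a :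
    relI 'C_[set: subg_of G]([set: subg_of G]^`(1))%g a <->
    relI 'C_[set: subg_of H]([set: subg_of H]^`(1))%g (subg_iso H phi a).
  have [g' isog] := subg_iso_isom iso_phi.
  exact: (galg_isom_cent_der1 pcK odd_p pT1 isog Dz1 Dz2).
have eqI := galg_isom_eq_card isof.
have eqC : #|'C_G(G^`(1))|%g = #|'C_H(H^`(1))|%g.
  by rewrite -(card_subg_cent_der1 G) -(card_subg_cent_der1 H); apply: eqI; apply: relC.
have eqD : #|G^`(1)|%g = #|H^`(1)|%g.
  by rewrite -(card_subg_der1 G) -(card_subg_der1 H); apply: eqI; apply: (galg_isom_der1 isof).
have eqZ : #|'Z(G) :&: G^`(1)|%g = #|'Z(H) :&: H^`(1)|%g.
  by rewrite -(card_subg_center_der1 G) -(card_subg_center_der1 H) (galg_isom_card_center_der1 pcK odd_p pT1 isof Dz1 Dz2).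
have eqUD j : #|mhoP p j 'C_G(G^`(1)) <*> G^`(1)|%g = #|mhoP p j 'C_H(H^`(1)) <*> H^`(1)|%g.
  rewrite -(card_subg_mho_joing p G) -(card_subg_mho_joing p H); apply: eqI.
  exact: (galg_isom_mho_der1 pcK odd_p pT1 isof Dz1 Dz2).
have eqUI j : #|mhoP p j 'C_G(G^`(1)) :&: G^`(1)|%g = #|mhoP p j 'C_H(H^`(1)) :&: H^`(1)|%g.
  have pz1 : (p.-elt z1)%g by apply: mem_p_elt pT1 _; rewrite inE.
  have pT2 : (p.-group [set: subg_of H])%g by rewrite (subg_pgroup p H).
  have pz2 : (p.-elt z2)%g by apply: mem_p_elt pT2 _; rewrite inE.
  have oz : #[z1]%g = #[z2]%g.
    by rewrite !orderE -Dz1 -Dz2 (card_subg_der1 G) (card_subg_der1 H).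
  have memz1 a : (z1 ^+ a)%g \in [set: subg_of G]^`(1)%g by rewrite Dz1 mem_cycle.
  have memz2 a : (z2 ^+ a)%g \in [set: subg_of H]^`(1)%g by rewrite Dz2 mem_cycle.
  have mem_eq := galg_isom_mho_pexp pcK odd_p pT1 isof Dz1 Dz2 j.
  rewrite -(card_subg_mho_setI p G) -(card_subg_mho_setI p H); apply/eqP; rewrite eqn_leq; apply/andP; split.
    apply: (card_cyclic_sub_leq pr_p pz1 oz); first by rewrite -Dz1 subsetIr.
    by move=> a; rewrite !inE memz1 memz2 !andbT mem_eq.
  apply: (card_cyclic_sub_leq pr_p pz2 (esym oz)); first by rewrite -Dz2 subsetIr.
  by move=> a; rewrite !inE memz1 memz2 !andbT mem_eq.
split.
- move=> phi iso_phi _.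
  exact: (relI_subg_iso iso_phi (sgval_cent_der1 G) (sgval_cent_der1 H) (relC _ iso_phi)).
- by move=> i i0; apply: jennings_quo_isog.
- exact: (@exponent_cent_der1_eq p).
- exact: (@cent_der1_quo_der1_isog p).
exact: (@cent_der1_abelianization_isog p).
Qed.
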